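(* (Maximal Selection Principle for Product-Szegö Dictionary) For any $\tilde g\in H^2(\mathbf D^2)$ one can find $(\tilde a,\tilde b)\in\mathbf D^2$ such that $$(\tilde a,\tilde b)=\arg\max\{|\langle\tilde g,e_a\otimes e_b\rangle|\ :\ a,b\in\mathbf D\},$$ that is, $|\langle\tilde g,e_{\tilde a}\otimes e_{\tilde b}\rangle|\ge|\langle\tilde g,e_a\otimes e_b\rangle|$ for all $a,b\in\mathbf D$.
   Context: $\mathbf D$ is the open unit disc and $\mathbf T=\partial\mathbf D$. $H^2(\mathbf D^2)$ is the space of holomorphic functions $f$ on $\mathbf D\times\mathbf D$ with $\sup_{0<r,s<1}\int_{-\pi}^\pi\int_{-\pi}^\pi|f(re^{it},se^{iu})|^2\,dt\,du<\infty$. It is identified isometrically, via non-tangential boundary limits, with the closed subspace $H^2(\mathbf T^2)$ of $L^2(\mathbf T^2)$ consisting of functions $\sum_{k,l\ge0}c_{kl}e^{i(kt+ls)}$, with inner product $\langle f,g\rangle=\frac1{4\pi^2}\int_{-\pi}^{\pi}\int_{-\pi}^{\pi}f(e^{it},e^{is})\overline{g(e^{it},e^{is})}\,dt\,ds$. For $a\in\mathbf D$, $e_a(z)=\frac{\sqrt{1-|a|^2}}{1-\overline az}$ is the normalized Szegö kernel, and $(e_a\otimes e_b)(z,w)=e_a(z)e_b(w)$. *)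

(* Defs.v *)
From HB Require Import structures.
From mathcomp Require Import all_boot all_order all_algebra.
From mathcomp Require Import complex.
From mathcomp Require Import all_classical all_reals all_analysis.

Set Implicit Arguments.
Unset Strict Implicit.
Unset Printing Implicit Defensive.

Import Order.TTheory GRing.Theory Num.Theory.
Import numFieldNormedType.Exports.

Local Open Scope classical_set_scope.
Local Open Scope ring_scope.

(* R[i] as a one-dimensional normed space over itself: differentiability below
   is complex differentiability. *)
HB.instance Definition _ (R : realType) := NormedModule.copy R[i] R[i]^o.

Definition disc (R : realType) : set R[i] := [set z | `|z| < 1].

Definition expi (R : realType) (t : R) : R[i] := (cos t +i* sin t)%C.

(* T^2 is parametrized by (t, u) |-> (e^{it}, e^{iu}). *)
Definition torus (R : realType) : set (R * R) :=
  `[- pi, pi] `*` `[- pi, pi].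

Notation lebesgue2 R :=
  (@lebesgue_measure R \x @lebesgue_measure R)%E (only parsing).

Definition holomorphic2 (R : realType) (f : R[i] * R[i] -> R[i]) : Prop :=
  forall z w : R[i], disc z -> disc w -> differentiable f (z, w).

Definition mean_square (R : realType) (f : R[i] * R[i] -> R[i]) (r s : R) :
    \bar R :=
  (\int[lebesgue2 R]_(x in @torus R)
     ((complex.Re `|f (r%:C%C * expi x.1, s%:C%C * expi x.2)|) ^+ 2)%:E)%E.

(* Membership in H^2(D^2); values of f outside D * D are irrelevant. *)
Definition hardy2 (R : realType) (f : R[i] * R[i] -> R[i]) : Prop :=
  holomorphic2 f /\
  (ereal_sup [set mean_square f r s | r in `]0%R, 1%R[ & s in `]0%R, 1%R[] <
   +oo)%E.

(* Non-tangential approach region at the boundary point zeta of the disc; it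
   is contained in the disc. *)
Definition stolz (R : realType) (alpha : R) (zeta : R[i]) : set R[i] :=
  [set z | `|z - zeta| < alpha%:C%C * (1 - `|z|)].

(* (z, w) --> (zeta, eta) non-tangentially in each variable, the two variables
   being otherwise independent, for every aperture. *)
Definition nontangential (R : realType) (zeta eta : R[i]) :
    set_system (R[i] * R[i]) :=
  [set A | forall alpha : R, 1 < alpha ->
     within (stolz alpha zeta `*` stolz alpha eta) (nbhs (zeta, eta)) A].

(* For f in H^2(D^2) the limit exists for almost every (t, u). *)
Definition boundary_value (R : realType) (f : R[i] * R[i] -> R[i])
    (x : R * R) : R[i] :=
  lim (f @ nontangential (expi x.1) (expi x.2)).

Definition integral_torus (R : realType) (h : R * R -> R[i]) : R[i] :=
  (Rintegral (lebesgue2 R) (@torus R) (fun x => complex.Re (h x)) +i*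
   Rintegral (lebesgue2 R) (@torus R) (fun x => complex.Im (h x)))%C.

Definition inner (R : realType) (f g : R[i] * R[i] -> R[i]) : R[i] :=
  ((4 * pi ^+ 2)^-1)%:C%C *
  integral_torus (fun x => boundary_value f x * (boundary_value g x)^*).

Definition szego (R : realType) (a z : R[i]) : R[i] :=
  sqrtC (1 - `|a| ^+ 2) / (1 - a^* * z).

Definition tensor (R : realType) (f g : R[i] -> R[i]) (p : R[i] * R[i]) :
    R[i] :=
  f p.1 * g p.2.

(* Main.v *)
Require Import Defs.
From mathcomp Require Import all_boot all_order all_algebra.
From mathcomp Require Import complex ring lra.
From mathcomp Require Import all_classical all_reals all_analysis.
From mathcomp Require Import measurable_realfun.
Import Order.TTheory GRing.Theory Num.Theory.
Import numFieldNormedType.Exports.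
Import Normc.
Local Open Scope classical_set_scope.
Local Open Scope ring_scope.

(** Write [F a b] for the inner product of [g] with the product Szego kernel of
    parameters [a] and [b]. The function [F] is continuous on the bidisc, and
    [F a b] tends to 0 when [a] or [b] approaches the unit circle, uniformly in
    the other parameter. If [F] does not vanish identically, then its modulus
    outside some closed polydisc is at most one of its values inside, and a
    continuous function attains its maximum on a closed polydisc.

    Both properties of [F] hold for the pairing of the kernels with any square
    integrable function on the torus. The boundary function [G] of [g] is one
    ([measurable_boundary_value], [boundary_value_square_integrable]). Indeed, by
    the Cauchy criterion, the set where the non-tangential limit exists is Borel
    ([measurable_limit_set], [limit_setP]); on it [G] is the limit of [g] along
    smaller tori, on which the mean squares of [g] are bounded, so that Fatou's
    lemma applies; off it [G] is a constant.

    Continuity ([szego_coef_dist_le]) follows from an explicit bound, uniform on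
    the torus, for the difference of two kernels. For the decay
    ([szego_coef_small]), the squared modulus of the kernel is a product of two
    Poisson kernels, each with integral [2 * pi] ([integral_poisson]), while its
    modulus has small integral when a parameter is near the circle
    ([normc_szego_small]). Thus the bounded part of [G] contributes little
    because the kernel is small in the mean, and the unbounded part because its
    norm is small while the norm of the kernel is fixed
    ([integral_kernel_small]). *)

(** * The modulus and the topology of the complex numbers *)

Section ComplexModulus.
Context {R : realType}.
Implicit Types z w : R[i].

Lemma normr_normc z : `|z| = (normc z)%:C%C.
Proof. by []. Qed.

Lemma normc_ge0 z : 0 <= normc z.
Proof. by case: z => x y; exact: sqrtr_ge0. Qed.

Lemma sqr_normc_ReIm z :
  normc z ^+ 2 = complex.Re z ^+ 2 + complex.Im z ^+ 2.
Proof. by case: z => x y /=; rewrite sqr_sqrtr// addr_ge0// sqr_ge0. Qed.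

Lemma normcD_le z w : normc (z + w) <= normc z + normc w.
Proof. exact: le_normcD. Qed.

Lemma normcBC z w : normc (z - w) = normc (w - z).
Proof. by rewrite -normcN opprB. Qed.

Lemma normc_conj z : normc z^* = normc z.
Proof. by case: z => x y /=; rewrite sqrrN. Qed.

Lemma normc_real (x : R) : normc x%:C%C = `|x|.
Proof. by rewrite /= expr0n/= addr0 sqrtr_sqr. Qed.

Lemma Re_le_normc z : `|complex.Re z| <= normc z.
Proof. by case: z => x y /=; rewrite -sqrtr_sqr ler_wsqrtr// lerDl sqr_ge0. Qed.

Lemma Im_le_normc z : `|complex.Im z| <= normc z.
Proof. by case: z => x y /=; rewrite -sqrtr_sqr ler_wsqrtr// lerDr sqr_ge0. Qed.

Lemma normc_le_ReIm z : normc z <= `|complex.Re z| + `|complex.Im z|.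
Proof.
rewrite -ler_sqr ?nnegrE ?normc_ge0 ?addr_ge0//.
rewrite sqr_normc_ReIm sqrrD !real_normK ?num_real// addrAC lerDl.
by rewrite mulrn_wge0// mulr_ge0.
Qed.

Lemma ler_normc z w : (`|z| <= `|w|) = (normc z <= normc w).
Proof. by rewrite !normr_normc lecR. Qed.

Lemma normc_expi (t : R) : normc (expi t) = 1.
Proof. by rewrite /= cos2Dsin2 sqrtr1. Qed.

Lemma discE z : disc z = (normc z < 1).
Proof. by rewrite /disc/= normr_normc -(ltcR (normc z)). Qed.

(** Balls of [R[i]] have complex radii; this reduces them to real radii. *)
Lemma nbhs_complexP z (A : set R[i]) :
  nbhs z A <-> exists2 e : R, 0 < e & forall w, normc (z - w) < e -> A w.
Proof.
split=> [/nbhs_normP[e /= e0 eA]|[e e0 eA]].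
  exists (complex.Re e); first by move: e0; rewrite ltcE => /andP[].
  move=> w we; apply: eA; rewrite /= normr_normc ltcE/= we andbT.
  by move: e0; rewrite ltcE eq_sym => /andP[].
apply/nbhs_normP; exists e%:C%C; first by rewrite /= ltcR.
by move=> w; rewrite /= normr_normc ltcR => /eA.
Qed.

Lemma cvg_complexP (T : Type) (F : set_system T) (FF : Filter F)
    (f : T -> R[i]) l :
  f @ F --> l <-> forall e : R, 0 < e -> \forall x \near F, normc (l - f x) < e.
Proof.
split=> [fl e e0|fl A /nbhs_complexP[e e0 eA]].
  by apply: (fl [set w | normc (l - w) < e]); apply/nbhs_complexP; exists e.
rewrite /nbhs/=; apply: filterS (fl e e0) => x; exact: eA.
Qed.

Lemma cvg_complex_parts (T : Type) (F : set_system T) (FF : Filter F)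
    (f : T -> R[i]) l :
  complex.Re (f x) @[x --> F] --> complex.Re l ->
  complex.Im (f x) @[x --> F] --> complex.Im l -> f @ F --> l.
Proof.
move=> /cvgrPdist_lt fr /cvgrPdist_lt fi; apply/cvg_complexP => e e0.
have e20 : 0 < e / 2 by rewrite divr_gt0.
near=> x; apply: le_lt_trans (normc_le_ReIm _) _.
rewrite raddfB raddfB/= (splitr e) ltrD//; near: x; [exact: fr|exact: fi].
Unshelve. all: by end_near. Qed.

Lemma cvg_Re (T : Type) (F : set_system T) (FF : Filter F) (f : T -> R[i]) l :
  f @ F --> l -> complex.Re (f x) @[x --> F] --> complex.Re l.
Proof.
move=> /cvg_complexP fl; apply/cvgrPdist_lt => e e0.
apply: filterS (fl e e0) => x; apply: le_lt_trans.
by rewrite -raddfB/= Re_le_normc.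
Qed.

Lemma cvg_Im (T : Type) (F : set_system T) (FF : Filter F) (f : T -> R[i]) l :
  f @ F --> l -> complex.Im (f x) @[x --> F] --> complex.Im l.
Proof.
move=> /cvg_complexP fl; apply/cvgrPdist_lt => e e0.
apply: filterS (fl e e0) => x; apply: le_lt_trans.
by rewrite -raddfB/= Im_le_normc.
Qed.

Lemma normc_dist z w : `|normc z - normc w| <= normc (z - w).
Proof.
rewrite ler_norml; apply/andP; split.
  by rewrite lerNl opprB lerBlDr normcBC (le_trans _ (normcD_le _ _))// subrK.
by rewrite lerBlDr (le_trans _ (normcD_le _ _))// subrK.
Qed.

Lemma cvg_normc (T : Type) (F : set_system T) (FF : Filter F)
    (f : T -> R[i]) l :
  f @ F --> l -> normc (f x) @[x --> F] --> normc l.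
Proof.
move=> /cvg_complexP fl; apply/cvgrPdist_lt => e e0.
by apply: filterS (fl e e0) => x; apply: le_lt_trans; exact: normc_dist.
Qed.

Lemma continuous_expi : continuous (@expi R).
Proof.
by move=> t; apply: cvg_complex_parts => /=;
  [exact: continuous_cos|exact: continuous_sin].
Qed.

End ComplexModulus.

(** * Borel sets of the plane *)

Section PlaneBorel.
Context {R : realType}.

(** The product sigma-algebra is generated by rectangles, and an open set is the
    union of the countably many squares with rational data that it contains. *)
Lemma open_measurable2 (U : set (R * R)) : open U -> measurable U.
Proof.
move=> oU.
pose box (k : rat * rat * rat) : set (R * R) :=
  ball (ratr k.1.1 : R) (ratr k.2) `*` ball (ratr k.1.2 : R) (ratr k.2).
have -> : U = \bigcup_k (if `[< box k `<=` U >] then box k else set0).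
  apply/seteqP; split => [x Ux|x [k _]]; last by case: asboolP => // kU /kU.
  have /nbhs_ballP[e/= e0 eU] : nbhs x U by apply: open_nbhs_nbhs.
  have /rat_in_itvoo[q] : 0 < e / 2 by rewrite divr_gt0.
  rewrite in_itv/= => /andP[q0 qe].
  have center (u : R) : exists p : rat, `|ratr p - u| < ratr q.
    have /rat_in_itvoo[p] : u < u + ratr q by rewrite ltrDl.
    rewrite in_itv/= => /andP[up pq]; exists p.
    by rewrite ger0_norm ?subr_ge0 ?(ltW up)// ltrBlDl.
  have [[p1 p1x] [p2 p2x]] := (center x.1, center x.2).
  have sub (u v w : R) : `|w - u| < ratr q -> `|w - v| < ratr q -> `|u - v| < e.
    move=> wu wv; rewrite -(subrKA w) (splitr e).
    apply: le_lt_trans (ler_normD _ _) _; rewrite (distrC u) ltrD//.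
      exact: lt_trans wu _.
    exact: lt_trans wv _.
  have boxU : box (p1, p2, q) `<=` U.
    by move=> y [/= y1 y2]; apply: eU; split; [apply: sub y1|apply: sub y2].
  by exists (p1, p2, q) => //; case: asboolP => // _; split.
apply: countable_bigcupT_measurable; first exact: countableP.
move=> k; case: asboolP => // _; rewrite /box.
apply: measurableX; apply: open_measurable; exact: ball_open.
Qed.

Lemma continuous_measurable_fun2 (f : R * R -> R) :
  continuous f -> measurable_fun setT f.
Proof.
move=> /continuousP cf; apply: (measurability _ (RGenOpens.measurableE R)).
move=> _ [_ [a [b ->] <-]]; rewrite setTI; apply: open_measurable2.
by apply: cf; exact: interval_open.
Qed.
End PlaneBorel.

(** * Non-tangential approach *)

Section NontangentialLimit.
Context {R : realType}.
Implicit Types (zeta eta z : R[i]) (x : R * R).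

Lemma stolzE (alpha : R) zeta z :
  stolz alpha zeta z = (normc (z - zeta) < alpha * (1 - normc z)).
Proof.
rewrite /stolz/= !normr_normc -(rmorph1 (real_complex R)) -rmorphB -rmorphM.
by rewrite ltcR.
Qed.

Definition radii (n : nat) : R := 1 - n.+2%:R^-1.

Lemma radii_itv n : radii n \in `]0, 1[.
Proof.
rewrite in_itv/= /radii subr_gt0 invf_lt1// ltr1n/=.
by rewrite ltrBlDr ltrDl invr_gt0.
Qed.

Lemma cvg_radii : radii n @[n --> \oo] --> (1 : R).
Proof.
rewrite -[X in _ --> X]subr0 /radii; apply: cvgB; first exact: cvg_cst.
by have := @cvg_harmonic R; rewrite -cvg_shiftS.
Qed.

Lemma stolz_radii (alpha : R) zeta n : 1 < alpha -> normc zeta = 1 ->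
  stolz alpha zeta ((radii n)%:C%C * zeta).
Proof.
move=> alpha1 zeta1; have := radii_itv n; rewrite in_itv/= => /andP[r0 r1].
rewrite stolzE -{2}(mul1r zeta) -mulrBl !normcM zeta1 !mulr1.
rewrite -(rmorph1 (real_complex R)) -rmorphB !normc_real.
rewrite ltr0_norm ?subr_lt0// gtr0_norm// opprB ltr_pMl ?subr_gt0//.
Qed.

#[global] Instance nontangential_filter zeta eta :
  Filter (nontangential zeta eta).
Proof.
split=> [alpha _|P Q FP FQ alpha a1|P Q PQ FP alpha a1].
- exact: filterT.
- by apply: filterI; [exact: FP|exact: FQ].
- by apply: filterS (FP alpha a1).
Qed.

Lemma nbhs_nontangential zeta eta :
  nontangential zeta eta --> (zeta, eta).
Proof. by move=> A nA alpha _; apply: filterS nA => p Ap _. Qed.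

Lemma cvg_radii_mul z : normc z = 1 -> (radii n)%:C%C * z @[n --> \oo] --> z.
Proof.
move=> z1; apply/cvg_complexP => e e0.
have /cvgrPdist_lt/(_ e e0) := cvg_radii.
apply: filterS => n; apply: le_lt_trans.
rewrite -{1}(mul1r z) -mulrBl normcM z1 mulr1 -(rmorph1 (real_complex R)).
by rewrite -rmorphB normc_real.
Qed.

(** Radii lie in every Stolz angle, so a non-tangential limit is in particular
    the limit along a sequence of dilations; this also shows that the
    non-tangential filter is proper. *)
Lemma cvg_radial zeta eta : normc zeta = 1 -> normc eta = 1 ->
  ((radii n)%:C%C * zeta, (radii n)%:C%C * eta) @[n --> \oo]
    --> nontangential zeta eta.
Proof.
move=> zeta1 eta1 A FA.
have /= FA2 := FA 2 (ltr1n _ 2).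
have : ((radii n)%:C%C * zeta, (radii n)%:C%C * eta) @[n --> \oo]
    --> (zeta, eta).
  exact: (cvg_pair (cvg_radii_mul _ zeta1) (cvg_radii_mul _ eta1)).
move=> /(_ _ FA2) [N _ NA]; exists N => // n /NA/= An.
apply: An.
by split => /=; apply: stolz_radii; rewrite ?ltr1n.
Qed.

#[global] Instance nontangential_proper x :
  ProperFilter (nontangential (expi x.1) (expi x.2)).
Proof.
split; last exact: nontangential_filter.
move=> F0; have := cvg_radial _ _ (normc_expi x.1) (normc_expi x.2).
by move=> /(_ _ F0) [N _ /(_ N)]; apply => /=.
Qed.
End NontangentialLimit.

(** * The set of points where the non-tangential limit exists *)

Section LimitSet.
Context {R : realType}.
Context (g : R[i] * R[i] -> R[i]).
Implicit Types (x : R * R) (p q : R[i] * R[i]) (alpha delta e : R).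

Definition approach alpha delta x : set (R[i] * R[i]) :=
  [set p | (stolz alpha (expi x.1) p.1 /\ normc (expi x.1 - p.1) < delta) /\
           (stolz alpha (expi x.2) p.2 /\ normc (expi x.2 - p.2) < delta)].

Lemma approach_leS alpha alpha' delta x : 0 < alpha -> alpha <= alpha' ->
  approach alpha delta x `<=` approach alpha' delta x.
Proof.
move=> a0 aa'.
have mono (zeta z : R[i]) : stolz alpha zeta z -> stolz alpha' zeta z.
  rewrite !stolzE => zs; apply: lt_le_trans (zs) _; rewrite ler_wpM2r//.
  have : 0 <= alpha * (1 - normc z) by exact: le_trans (normc_ge0 _) (ltW zs).
  by rewrite pmulr_rge0.
by move=> p [[s1 d1] [s2 d2]]; split; split => //; exact: mono.
Qed.

Lemma exists_invS_lt e : 0 < e -> exists n, n.+1%:R^-1 < e.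
Proof.
move=> e0; have [N _ /(_ N)/= NP] := near_infty_natSinv_lt (PosNum e0).
by exists N; apply: NP => /=.
Qed.

Lemma within_approachP alpha x (A : set (R[i] * R[i])) :
  within (stolz alpha (expi x.1) `*` stolz alpha (expi x.2))
    (nbhs (expi x.1, expi x.2)) A <->
  exists2 delta, 0 < delta & approach alpha delta x `<=` A.
Proof.
split=> [[[B1 B2] /= [/nbhs_complexP[d1 d10 B1d] /nbhs_complexP[d2 d20 B2d]]]
         BA|[d d0 dA]].
  exists (Num.min d1 d2); first by rewrite lt_min d10.
  move=> [p1 p2] [/= [s1 +] [s2 +]]; rewrite !lt_min.
  by move=> /andP[/B1d B1p _] /andP[_ /B2d B2p]; exact: (BA (p1, p2)).
exists ([set z | normc (expi x.1 - z) < d], [set z | normc (expi x.2 - z) < d]).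
  by split; apply/nbhs_complexP; exists d.
by move=> [p1 p2] [/= n1 n2] [/= s1 s2]; apply: dA.
Qed.

Lemma open_approach alpha delta p : open [set x | approach alpha delta x p].
Proof.
have o1 (z : R[i]) : open [set t : R | stolz alpha (expi t) z].
  rewrite (_ : mkset _ = (fun t => normc (z - expi t)) @^-1`
    [set y | y < alpha * (1 - normc z)]); last first.
    by apply/seteqP; split => t /=; rewrite stolzE.
  apply: open_comp; last exact: open_lt.
  move=> t _; apply: cvg_normc; apply/cvg_complexP => e e0.
  have /cvg_complexP/(_ e e0) := continuous_expi t.
  by apply: filterS => s; rewrite normcBC opprB [z - _ + _]addrC subrKA.
have o2 (z : R[i]) : open [set t : R | normc (expi t - z) < delta].
  apply: (@open_comp _ _ (fun t => normc (expi t - z)) [set y | y < delta]).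
    move=> t _; apply: cvg_normc; apply/cvg_complexP => e e0.
    have /cvg_complexP/(_ e e0) := continuous_expi t.
    by apply: filterS => s; rewrite opprB subrKA.
  exact: open_lt.
rewrite (_ : mkset _ = (fst @^-1` ([set t : R | stolz alpha (expi t) p.1] `&`
      [set t : R | normc (expi t - p.1) < delta])) `&`
   (snd @^-1` ([set t : R | stolz alpha (expi t) p.2] `&`
      [set t : R | normc (expi t - p.2) < delta]))) //.
by apply: openI; apply: open_comp => [x _|]; [exact: cvg_fst|exact: openI
  |exact: cvg_snd|exact: openI].
Qed.

Definition oscillates e alpha delta : set (R * R) :=
  [set x | exists p q, [/\ approach alpha delta x p, approach alpha delta x q
     & e < normc (g p - g q)]].

(** Once two points of the bidisc at which [g] takes distant values are chosen,
    the points [x] whose approach regions contain both form an open set. The set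
    of all [x] whose approach region contains such a pair is a union of these. *)
Lemma open_oscillates e alpha delta : open (oscillates e alpha delta).
Proof.
rewrite (_ : oscillates _ _ _ = \bigcup_(pq in [set pq : (R[i] * R[i]) *
    (R[i] * R[i]) | e < normc (g pq.1 - g pq.2)])
  ([set x | approach alpha delta x pq.1] `&`
   [set x | approach alpha delta x pq.2])); last first.
  apply/seteqP; split=> [x [p [q [xp xq pq]]]|x [[p q] /= pq [xp xq]]].
    by exists (p, q).
  by exists p, q.
by apply: bigcup_open => pq _; apply: openI; exact: open_approach.
Qed.

(** The Cauchy criterion for the non-tangential limit, with aperture, oscillation
    and distance to the boundary restricted to countable families. The apertures
    start at 2 because Stolz angles are only considered for apertures above 1. *)
Definition limit_set : set (R * R) := \bigcap_k \bigcap_n \bigcup_m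
  ~` oscillates n.+1%:R^-1 k.+2%:R m.+1%:R^-1.

Lemma measurable_limit_set : measurable limit_set.
Proof.
apply: bigcapT_measurable => k; apply: bigcapT_measurable => n.
apply: bigcupT_measurable => m; apply: measurableC; apply: open_measurable2.
exact: open_oscillates.
Qed.

Lemma real_cauchy_cvg (u : R ^nat) :
  (forall e, 0 < e -> exists a, \forall n \near \oo, `|a - u n| < e) -> cvgn u.
Proof.
move=> uC; apply/cauchy_cvgP; apply: cauchy_exP => e e0.
have [a ae] := uC e e0; exists a; exact: ae.
Qed.

(** Given the Cauchy criterion, the limit is first found along the radii, where
    it is the same for all apertures, and the oscillation bound then extends it
    to the whole approach region. *)
Lemma limit_setP x :
  limit_set x <-> cvg (g @ nontangential (expi x.1) (expi x.2)).
Proof.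
split=> [Ex|/cvg_ex[l gl] k _ n _].
  pose u n := g ((radii n)%:C%C * expi x.1, (radii n)%:C%C * expi x.2).
  have osc e alpha : 0 < e -> 0 < alpha -> exists2 delta, 0 < delta &
      forall p q, approach alpha delta x p -> approach alpha delta x q ->
      normc (g p - g q) < e.
    move=> e0 a0.
    have [k ak] : exists k, alpha <= k.+2%:R.
      exists (Num.trunc alpha); rewrite ltW// (lt_trans (truncnS_gt alpha))//.
      by rewrite ltr_nat.
    have [n ne] := exists_invS_lt _ e0.
    have [m _ mP] := Ex k Logic.I n Logic.I.
    exists m.+1%:R^-1; first by rewrite invr_gt0.
    move=> p q xp xq; apply: le_lt_trans ne; rewrite leNgt; apply/negP => pq.
    by apply: mP; exists p, q; split => //; apply: approach_leS ak _ _.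
  have radial alpha delta : 1 < alpha -> 0 < delta -> \forall n \near \oo,
      approach alpha delta x
       ((radii n)%:C%C * expi x.1, (radii n)%:C%C * expi x.2).
    move=> a1 d0.
    have near_radii (t : R) : \forall n \near \oo,
        stolz alpha (expi t) ((radii n)%:C%C * expi t) /\
        normc (expi t - (radii n)%:C%C * expi t) < delta.
      have /cvg_complexP/(_ delta d0) := cvg_radii_mul _ (normc_expi t).
      apply: filterS => n ?; split => //.
      by apply: stolz_radii => //; exact: normc_expi.
    exact: filterI (near_radii x.1) (near_radii x.2).
  have uC e : 0 < e -> exists a, \forall n \near \oo, normc (a - u n) < e.
    move=> e0; have [d d0 dP] := osc e 2 e0 (ltr0n _ 2).
    have /radial/(_ d0) [N _ NP] : (1 : R) < 2 by rewrite ltr1n.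
    exists (u N); exists N => // n Nn; apply: dP; apply: NP => //=.
  have cr : cvgn (fun n => complex.Re (u n)).
    apply: real_cauchy_cvg => e /uC[a ae]; exists (complex.Re a).
    apply: filterS ae => n; apply: le_lt_trans.
    by rewrite -raddfB/= Re_le_normc.
  have ci : cvgn (fun n => complex.Im (u n)).
    apply: real_cauchy_cvg => e /uC[a ae]; exists (complex.Im a).
    apply: filterS ae => n; apply: le_lt_trans.
    by rewrite -raddfB/= Im_le_normc.
  have /cvg_ex[lr ur] := cr; have /cvg_ex[li ui] := ci.
  have ul : u @ \oo --> (lr +i* li)%C by apply: cvg_complex_parts.
  apply/cvg_ex; exists (lr +i* li)%C; apply/cvg_complexP => e e0 alpha a1.
  have e20 : 0 < e / 2 by rewrite divr_gt0.
  have [d d0 dP] := osc (e / 2) alpha e20 (lt_trans ltr01 a1).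
  apply/within_approachP; exists d => // p xp /=.
  have /cvg_complexP/(_ _ e20) uln := ul.
  have [N _ /(_ N)/= []//] := filterI (radial alpha d a1 d0) uln.
  move=> xN lN; rewrite (splitr e) -(subrKA (u N)).
  by apply: le_lt_trans (normcD_le _ _) _; rewrite ltrD// dP.
have n0 : 0 < n.+1%:R^-1 / 2 :> R by rewrite divr_gt0.
have /cvg_complexP/(_ _ n0) /(_ k.+2%:R) := gl.
rewrite ltr1n => /(_ isT) /within_approachP[d d0 dP].
have [m md] := exists_invS_lt _ d0.
exists m => // -[p [q [xp xq]]]; apply/negP; rewrite -leNgt.
have sub : approach k.+2%:R m.+1%:R^-1 x `<=` approach k.+2%:R d x.
  by move=> r [[s1 r1] [s2 r2]]; split; split => //; exact: lt_trans md.
have [lp lq] := (dP _ (sub _ xp), dP _ (sub _ xq)).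
rewrite -(subrKA l) [leRHS]splitr; apply: le_trans (normcD_le _ _) _.
by rewrite lerD ?(ltW lq)// normcBC ltW.
Qed.

End LimitSet.

(** * The boundary function is measurable and square integrable *)

Section BoundaryValue.
Context {R : realType}.
Context (g : R[i] * R[i] -> R[i]).
Implicit Types (x : R * R).

Definition dilate n x :=
  g ((radii n)%:C%C * expi x.1, (radii n)%:C%C * expi x.2).

Lemma boundary_value_radial x : limit_set g x ->
  dilate n x @[n --> \oo] --> boundary_value g x.
Proof.
move=> /limit_setP gx.
exact: cvg_comp (cvg_radial _ _ (normc_expi x.1) (normc_expi x.2)) gx.
Qed.

Lemma boundary_value_divergent x : ~ limit_set g x ->
  boundary_value g x = point.
Proof. by move=> /limit_setP; exact: dvgP. Qed.

Context (g_holo : holomorphic2 g).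

Lemma continuous_dilate n : continuous (dilate n).
Proof.
have := @radii_itv R n; rewrite in_itv/= => /andP[r0 r1] x.
have scale (T : topologicalType) (f : T -> R[i]) (y : T) :
    {for y, continuous f} ->
    {for y, continuous (fun u => (radii n)%:C%C * f u)}.
  move=> cf; apply/cvg_complexP => e e0.
  have /cvg_complexP/(_ e e0) := cf; apply: filterS => u; apply: le_lt_trans.
  rewrite -mulrBr normcM normc_real ger0_norm ?(ltW r0)//.
  by rewrite ler_piMl ?normc_ge0 ?(ltW r1).
apply: (@cvg_comp _ _ _ (fun x => ((radii n)%:C%C * expi x.1,
    (radii n)%:C%C * expi x.2)) g _
    (nbhs ((radii n)%:C%C * expi x.1, (radii n)%:C%C * expi x.2))).
  apply: (cvg_pair (scale _ (fun x : R * R => expi x.1) x _)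
                   (scale _ (fun x : R * R => expi x.2) x _)).
    by apply: continuous_comp; [exact: cvg_fst|exact: continuous_expi].
  by apply: continuous_comp; [exact: cvg_snd|exact: continuous_expi].
have rdisc (t : R) : disc ((radii n)%:C%C * expi t).
  by rewrite discE normcM normc_expi mulr1 normc_real ger0_norm// ltW.
exact: (differentiable_continuous (g_holo _ _ (rdisc x.1) (rdisc x.2))).
Qed.

(** On the Borel set where the limit exists the boundary function is a pointwise
    limit of continuous functions; elsewhere [lim] returns a default value, so
    it is constant there. *)
Lemma measurable_boundary_value :
  measurable_fun setT (fun x => complex.Re (boundary_value g x)) /\
  measurable_fun setT (fun x => complex.Im (boundary_value g x)).
Proof.
have part (phi : R[i] -> R) : (forall (T : Type) (F : set_system T)
      (FF : Filter F) (f : T -> R[i]) l,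
      f @ F --> l -> phi (f x) @[x --> F] --> phi l) ->
    measurable_fun setT (fun x => phi (boundary_value g x)).
  move=> phiC; have mE := @measurable_limit_set _ g.
  rewrite -(setUv (limit_set g)); apply/measurable_funU => //.
    exact: measurableC.
  split.
    apply: (@measurable_fun_cvg _ _ _ _ (fun n x => phi (dilate n x))).
      move=> n; apply: measurable_funTS; apply: continuous_measurable_fun2.
      by move=> x; apply: phiC; exact: continuous_dilate.
    by move=> x Ex; apply: phiC; exact: boundary_value_radial.
  apply: (eq_measurable_fun (fun=> phi point)) => [x|].
    by rewrite inE => /boundary_value_divergent ->.
  exact: measurable_cst.
by split; apply: part; [exact: @cvg_Re|exact: @cvg_Im].
Qed.

End BoundaryValue.

Section SquareIntegrable.
Context {R : realType}.

Lemma measurable_torus : measurable (@torus R).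
Proof. by apply: measurableX; exact: measurable_itv. Qed.

Lemma lebesgue2_torus : (lebesgue2 R) (@torus R) = ((2 * pi) ^+ 2)%:E.
Proof.
have itvE : lebesgue_measure (`[- pi, pi]%classic : set R) = (2 * pi)%:E.
  rewrite lebesgue_measure_itv/= lte_fin gtrN ?pi_gt0//.
  by rewrite -EFinD opprK mulr2n mulrDl mul1r.
rewrite expr2 EFinM -itvE; apply: product_measure1E; exact: measurable_itv.
Qed.

Lemma limn_einf_le (u : (\bar R)^nat) (M : \bar R) :
  (forall n, u n <= M)%E -> (limn_einf u <= M)%E.
Proof.
move=> uM; rewrite limn_einf_lim; apply: lime_le; first exact: is_cvg_einfs.
near=> n; apply: le_trans (uM n); apply: ereal_inf_lbound; exists n => //=.
Unshelve. all: by end_near. Qed.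

Lemma measurable_normc (f : R * R -> R[i]) :
  measurable_fun setT (fun x => complex.Re (f x)) ->
  measurable_fun setT (fun x => complex.Im (f x)) ->
  measurable_fun setT (fun x => normc (f x)).
Proof.
move=> mr mi; rewrite (_ : (fun x => normc (f x)) = (fun x =>
  Num.sqrt (complex.Re (f x) ^+ 2 + complex.Im (f x) ^+ 2))).
  apply: (@measurableT_comp _ _ _ _ _ _ (@Num.sqrt R)).
    by apply: continuous_measurable_fun; exact: sqrt_continuous.
  by apply: measurable_funD; exact: measurable_funX.
by apply/funext => x; case: (f x).
Qed.

Context (g : R[i] * R[i] -> R[i]).
Context (hg : hardy2 g).

(** Fatou's lemma along the dilations. Where the limit fails to exist the
    dilations are replaced by the constant default value, so that the modified
    sequence converges everywhere; this adds at most the square of a constant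
    times the area of the torus to the integrals. *)
Lemma boundary_value_square_integrable :
  (\int[lebesgue2 R]_(x in @torus R)
    ((normc (boundary_value g x)) ^+ 2)%:E < +oo)%E.
Proof.
have [g_holo g_sup] := hg.
pose C := normc (point : R[i]) ^+ 2.
pose f n x := normc (dilate g n x).
pose F n (x : R * R) := if x \in limit_set g then f n x ^+ 2 else C.
have mf n : measurable_fun setT (f n).
  apply: measurable_normc; apply: continuous_measurable_fun2 => x.
    by apply: cvg_Re; exact: continuous_dilate.
  by apply: cvg_Im; exact: continuous_dilate.
have mf2 n : measurable_fun setT (fun x => (f n x ^+ 2)%:E).
  by apply/measurable_EFinP; apply: measurable_funX; exact: mf.
have mF n : measurable_fun setT (F n).
  apply: measurable_fun_if => //.
  - apply: (measurable_fun_bool true).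
    rewrite (_ : _ @^-1` _ = limit_set g).
      exact: measurableI _ (measurable_limit_set _).
    by apply/seteqP; split => x /= Ex; [exact: set_mem|exact: mem_set].
  - by apply: measurable_funTS; exact: measurable_funX.
have cF x : F n x @[n --> \oo] --> normc (boundary_value g x) ^+ 2.
  rewrite /F; have [Ex|Ex] := pselect (limit_set g x).
    rewrite (mem_set Ex) expr2; under eq_fun do rewrite expr2.
    by apply: cvgM; apply: cvg_normc; exact: boundary_value_radial.
  by rewrite (memNset Ex) boundary_value_divergent//; exact: cvg_cst.
pose M : \bar R := (ereal_sup
    [set mean_square g r s | r in `]0%R, 1%R[ & s in `]0%R, 1%R[]
  + (C * (2 * pi) ^+ 2)%:E)%E.
have FM n : (\int[lebesgue2 R]_(x in @torus R) (F n x)%:E <= M)%E.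
  apply: (@le_trans _ _ (\int[lebesgue2 R]_(x in @torus R)
      ((f n x ^+ 2)%:E + C%:E))%E).
    apply: ge0_le_integral => //.
    - exact: measurable_torus.
    - by move=> x _; rewrite lee_fin /F; case: ifP => _; rewrite ?sqr_ge0.
    - by apply: measurable_funTS; apply/measurable_EFinP; exact: mF.
    - by apply: measurable_funTS; apply: emeasurable_funD;
        [exact: mf2|exact: measurable_cst].
    - move=> x _; rewrite -EFinD lee_fin /F; case: ifP => _.
        by rewrite lerDl sqr_ge0.
      by rewrite lerDr sqr_ge0.
  rewrite ge0_integralD//; last 4 first.
  - exact: measurable_torus.
  - by move=> x _; rewrite lee_fin sqr_ge0.
  - by apply: measurable_funTS; exact: mf2.
  - by move=> x _; rewrite lee_fin sqr_ge0.
  rewrite integral_cst; last exact: measurable_torus.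
  rewrite [X in (C%:E * X)%E]lebesgue2_torus -EFinM /M leeD//.
  apply: ereal_sup_ubound => /=; exists (radii n); first exact: radii_itv.
  by exists (radii n) => //; exact: radii_itv.
have Moo : (M < +oo)%E by rewrite lte_add_pinfty// ltry.
apply: le_lt_trans Moo.
apply: (@le_trans _ _ (limn_einf (fun n =>
    \int[lebesgue2 R]_(x in @torus R) (F n x)%:E))%E).
  apply: le_trans (fatou _ _ _ _).
  - rewrite le_eqVlt; apply/orP; left; apply/eqP; apply: eq_integral => x _.
    have cFx : (F n x)%:E @[n --> \oo] --> (normc (boundary_value g x) ^+ 2)%:E.
      by apply: cvg_EFin; [exact: nearW|exact: cF].
    rewrite is_cvg_limn_einfE; first by rewrite (cvg_lim _ cFx).
    by apply/cvg_ex; eexists; exact: cFx.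
  - exact: measurable_torus.
  - by move=> n; apply: measurable_funTS; apply/measurable_EFinP; exact: mF.
  - by move=> n x _; rewrite lee_fin /F; case: ifP => _; rewrite ?sqr_ge0.
exact: limn_einf_le.
Qed.

End SquareIntegrable.

(** * The Poisson kernel *)

Section Poisson.
Context {R : realType}.
Implicit Types (a : R[i]) (t : R).

Definition poisson_kernel a t : R :=
  (1 - normc a ^+ 2) / normc (1 - a^* * expi t) ^+ 2.

(** The product [a^* * expi t] is handled through its real coordinates so that
    the Poisson kernel can be integrated by means of a real primitive; each is,
    up to sign, the derivative of the other in [t]. *)
Definition rot_re a t := complex.Re a * cos t + complex.Im a * sin t.
Definition rot_im a t := complex.Re a * sin t - complex.Im a * cos t.

Lemma conj_mul_expi a t : a^* * expi t = (rot_re a t +i* rot_im a t)%C.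
Proof.
case: a => x y; rewrite /rot_re /rot_im /expi; apply/eqP; rewrite eq_complex/=.
by rewrite mulNr opprK mulNr eqxx addrC/= addrC.
Qed.

Lemma sqr_rot a t : rot_re a t ^+ 2 + rot_im a t ^+ 2 = normc a ^+ 2.
Proof.
rewrite -(sqr_normc_ReIm (rot_re a t +i* rot_im a t)%C) -conj_mul_expi.
by rewrite normcM normc_conj normc_expi mulr1.
Qed.

Lemma sub1_rot_re_gt0 a t : disc a -> 0 < 1 - rot_re a t.
Proof.
rewrite discE subr_gt0 => a1; apply: le_lt_trans a1.
rewrite -[normc a]mulr1 -(normc_expi t) -normc_conj -normcM conj_mul_expi.
apply: le_trans (ler_norm _) _.
exact: (Re_le_normc (rot_re a t +i* rot_im a t)%C).
Qed.

Lemma poissonE a t :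
  poisson_kernel a t =
  (1 - (rot_re a t ^+ 2 + rot_im a t ^+ 2)) / ((1 - rot_re a t) ^+ 2 + rot_im a t ^+ 2).
Proof.
rewrite /poisson_kernel conj_mul_expi -(sqr_rot a t); congr (_ / _).
by rewrite sqr_normc_ReIm/= sub0r sqrrN.
Qed.

(** With [w := a^* * expi t], the Poisson kernel is [1 + 2 Re (w / (1 - w))], and
    [Re (w / (1 - w))] is minus the derivative in [t] of the argument of
    [1 - w]. That argument is given by [atan] because [1 - w] has positive real
    part. *)
Definition poisson_primitive a t :=
  t + 2 * atan (rot_im a t * (1 - rot_re a t)^-1).

Lemma is_derive_primitive a t : disc a ->
  is_derive t 1 (poisson_primitive a) (poisson_kernel a t).
Proof.
move=> a1; have p1 := sub1_rot_re_gt0 a t a1.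
have dp : is_derive t 1 (rot_re a) (- rot_im a t).
  apply: (is_derive_eq (is_deriveD (is_deriveZ (complex.Re a) (is_derive_cos t))
    (is_deriveZ (complex.Im a) (is_derive_sin t)))).
  rewrite /rot_im /GRing.scale/=; ring.
have dq : is_derive t 1 (rot_im a) (rot_re a t).
  apply: (is_derive_eq (is_deriveB (is_deriveZ (complex.Re a) (is_derive_sin t))
    (is_deriveZ (complex.Im a) (is_derive_cos t)))).
  rewrite /rot_re /GRing.scale/=; ring.
have d1p : is_derive t 1 (fun u => 1 - rot_re a u) (rot_im a t).
  apply: (is_derive_eq (is_deriveB (is_derive_cst (1 : R) t 1) dp)).
  by rewrite sub0r opprK.
have dV : is_derive t 1 (fun u => (1 - rot_re a u)^-1)
    (- (rot_im a t / (1 - rot_re a t) ^+ 2)).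
  apply: is_derive_eq (is_deriveV _ d1p) _; first by rewrite gt_eqF.
  by rewrite /GRing.scale/= mulNr mulrC.
have dM := is_deriveM dq dV.
have dA := is_derive1_comp (is_derive1_atan _) dM.
have dP := is_deriveD (is_derive_id t 1) (is_deriveZ 2 dA).
apply: (is_derive_eq dP).
rewrite poissonE /GRing.scale/=.
rewrite -[(rot_im a * _) t]/(rot_im a t * (1 - rot_re a t)^-1).
have pq0 : (1 - rot_re a t) ^+ 2 + rot_im a t ^+ 2 != 0.
  by rewrite gt_eqF// ltr_pwDl ?sqr_ge0// exprn_gt0.
field.
by rewrite pq0 gt_eqF//=.
Qed.

Lemma continuous_poisson a : disc a -> continuous (poisson_kernel a).
Proof.
move=> a1; rewrite (_ : poisson_kernel a = fun t =>
  (1 - normc a ^+ 2) * ((1 - rot_re a t) ^+ 2 + rot_im a t ^+ 2)^-1); last first.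
  by apply/funext => t; rewrite poissonE sqr_rot.
move=> t.
have cp : {for t, continuous (rot_re a)}.
  by apply: cvgD; apply: cvgMl_tmp; [exact: continuous_cos|exact: continuous_sin].
have cq : {for t, continuous (rot_im a)}.
  by apply: cvgB; apply: cvgMl_tmp; [exact: continuous_sin|exact: continuous_cos].
apply: cvgMl_tmp; apply: cvgV.
  by rewrite gt_eqF// ltr_pwDl ?sqr_ge0// exprn_gt0// sub1_rot_re_gt0.
apply: cvgD; rewrite expr2; under eq_fun do rewrite expr2.
  by apply: cvgM; apply: cvgB => //; exact: cvg_cst.
by apply: cvgM.
Qed.

Lemma integral_poisson a : disc a ->
  (\int[lebesgue_measure]_(t in `[(- pi)%R, pi]) (poisson_kernel a t)%:E =
   (2 * pi)%:E)%E.
Proof.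
move=> a1; rewrite (@continuous_FTC2 _ _ (poisson_primitive a)).
- have -> : poisson_primitive a pi = pi + (poisson_primitive a (- pi) + pi).
    rewrite /poisson_primitive /rot_re /rot_im cosN sinN cospi sinpi oppr0; ring.
  by rewrite -EFinB; congr _%:E; ring.
- by rewrite gtrN// pi_gt0.
- exact/continuous_subspaceT/continuous_poisson.
- have cF t : {for t, continuous (poisson_primitive a)}.
    apply: differentiable_continuous; apply/derivable1_diffP.
    by have [] := is_derive_primitive a t a1.
  split => [t _||]; first by have [] := is_derive_primitive a t a1.
    by apply: cvg_at_right_filter; exact: cF.
  by apply: cvg_at_left_filter; exact: cF.
- move=> t _; rewrite derive1E.
  by have [_ ->] := is_derive_primitive a t a1.
Qed.
End Poisson.

(** * The modulus of the normalized Szego kernel *)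

Section Kernel.
Context {R : realType}.
Implicit Types (a b : R[i]) (t : R).

Lemma sub1_conj_ge a t : 1 - normc a <= normc (1 - a^* * expi t).
Proof.
rewrite lerBlDr -{1}(@normc1 R) -{1}(subrK (a^* * expi t) 1).
by rewrite (le_trans (normcD_le _ _))// normcM normc_conj normc_expi mulr1.
Qed.

Lemma sub1_conj_gt0 a t : disc a -> 0 < normc (1 - a^* * expi t).
Proof. by rewrite discE -subr_gt0 => /lt_le_trans; apply; exact: sub1_conj_ge. Qed.

Lemma sqr_normc_lt1 a : disc a -> normc a ^+ 2 < 1.
Proof. by rewrite discE => a1; rewrite expr_lt1// normc_ge0. Qed.

Lemma poisson_ge0 a t : disc a -> 0 <= poisson_kernel a t.
Proof. by move=> /sqr_normc_lt1 a1; rewrite divr_ge0 ?sqr_ge0// subr_ge0 ltW. Qed.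

Lemma sqr_normc_szego a t : disc a ->
  normc (szego a (expi t)) ^+ 2 = poisson_kernel a t.
Proof.
move=> a1; rewrite /szego normcM normcV exprMn exprVn /poisson_kernel.
congr (_ / _).
rewrite expr2 -normcM -expr2 sqrtCK normr_normc -(rmorph1 (real_complex R)).
rewrite -rmorphXn -rmorphB normc_real ger0_norm// subr_ge0 ltW//.
exact: sqr_normc_lt1.
Qed.

Lemma normc_szego_le a t : disc a ->
  normc (szego a (expi t)) <= 1 + poisson_kernel a t.
Proof.
move=> a1; rewrite -sqr_normc_szego//; set q := normc _.
by have := sqr_ge0 (q - 1); nra.
Qed.

(** This is how the normalized Szego kernel tends to 0 in the mean when its
    parameter tends to the circle. Where [normc (1 - a^* * expi t)] exceeds [d],
    the kernel is uniformly small. The set of the other [t] is small, and the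
    Poisson kernel at the point [a'] of modulus [1 - d] on the radius through
    [a] is at least [1 / (4 * d)] on it, because [a'] is at distance at most [d]
    from [a]; hence it majorizes the indicator of this set up to a factor. Such
    a majorant is convenient because all Poisson kernels have the same integral. *)
Lemma normc_szego_small (e : R) : 0 < e <= 1 -> exists2 r : R, r < 1 &
  forall a, disc a -> r < normc a -> exists2 a', disc a' &
  forall t, normc (szego a (expi t)) <=
    e * (1 + poisson_kernel a t + poisson_kernel a' t).
Proof.
move=> /andP[e0 e1].
(* With this [d] the indicator of the set just described, divided by [2 * e],
   is at most [e] times the Poisson kernel at [a']. *)
have [d dE] : exists d, d = e ^+ 2 / 2 by eexists.
have d0 : 0 < d by rewrite dE divr_gt0 ?exprn_gt0.
have d12 : d <= 1 / 2 by rewrite dE; nra.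
exists (1 - e ^+ 2 * d ^+ 2 / 2).
  by rewrite gtrBl divr_gt0// mulr_gt0// exprn_gt0.
move=> a a1 ra; have := a1; rewrite discE => na1.
have e21 : e ^+ 2 <= 1 by rewrite expr_le1// ltW.
have dd : d ^+ 2 <= d by nra.
have ed : e ^+ 2 * d ^+ 2 <= d ^+ 2 by rewrite ler_piMl ?sqr_ge0.
have da : 1 - d <= normc a by lra.
have na0 : 0 < normc a by lra.
pose c := (1 - d) / normc a.
have na' : normc (c%:C%C * a) = 1 - d.
  rewrite normcM normc_real ger0_norm ?divfK ?gt_eqF//.
  by rewrite divr_ge0 ?normc_ge0//; nra.
have a'1 : disc (c%:C%C * a) by rewrite discE na' gtrBl.
exists (c%:C%C * a) => // t.
have [Pa Pa'] := (poisson_ge0 a t a1, poisson_ge0 _ t a'1).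
have Qa := sqr_normc_szego a t a1.
have Q0 := normc_ge0 (szego a (expi t)).
have D0 := sub1_conj_gt0 a t a1.
have D'0 := sub1_conj_gt0 _ t a'1.
have [Dd|dD] := leP (normc (1 - a^* * expi t)) d.
  have D'd : normc (1 - (c%:C%C * a)^* * expi t) <= 2 * d.
    have -> : 1 - (c%:C%C * a)^* * expi t = (1 - a^* * expi t) +
      ((a - c%:C%C * a)^* * expi t) by rewrite rmorphB mulrBl addrA subrK.
    apply: le_trans (normcD_le _ _) _.
    rewrite mulr2n mulrDl mul1r lerD// normcM normc_expi mulr1 normc_conj.
    have -> : a - c%:C%C * a = (1 - c)%:C%C * a.
      by rewrite rmorphB rmorph1 mulrBl mul1r.
    rewrite normcM normc_real -[X in _ * X]ger0_norm ?normc_ge0// -normrM.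
    rewrite mulrBl mul1r /c divfK ?gt_eqF// ler_norml.
    by apply/andP; split; lra.
  have P'd : 1 / (4 * d) <= poisson_kernel (c%:C%C * a) t.
    rewrite /poisson_kernel na' ler_pdivlMr ?exprn_gt0//.
    apply: (@le_trans _ _ (1 / (4 * d) * (2 * d) ^+ 2)).
      apply: ler_wpM2l; first by rewrite mul1r invr_ge0 pmulr_rge0 ?(ltW d0).
      by rewrite ler_sqr ?nnegrE ?normc_ge0 ?pmulr_rge0 ?(ltW d0).
    have -> : 1 / (4 * d) * (2 * d) ^+ 2 = d by field; rewrite gt_eqF.
    by nra.
  have eP' : 1 / (2 * e) <= e * poisson_kernel (c%:C%C * a) t.
    apply: (@le_trans _ _ (e * (1 / (4 * d)))); last by rewrite ler_pM2l.
    by rewrite dE le_eqVlt; apply/orP; left; apply/eqP; field; rewrite gt_eqF.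
  have amgm : normc (szego a (expi t)) <= e * poisson_kernel a t + 1 / (2 * e).
    rewrite -Qa; set q := normc _ in Q0 *.
    have -> : e * q ^+ 2 + 1 / (2 * e) =
      q + ((e * q - 1 / 2) ^+ 2 + 1 / 4) / e by field; rewrite gt_eqF.
    by rewrite lerDl divr_ge0 ?(ltW e0)// addr_ge0 ?sqr_ge0// divr_ge0.
  nra.
have Qe : normc (szego a (expi t)) <= e.
  rewrite -ler_sqr ?nnegrE ?(ltW e0)// Qa /poisson_kernel.
  rewrite ler_pdivrMr ?exprn_gt0//.
  apply: (@le_trans _ _ (e ^+ 2 * d ^+ 2)).
    by have := normc_ge0 a; nra.
  apply: ler_wpM2l; first exact: sqr_ge0.
  by rewrite ler_sqr ?nnegrE ?normc_ge0 ?(ltW d0) ?(ltW dD).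
nra.
Qed.

End Kernel.

(** * Integrals over the torus *)

Section TorusIntegral.
Context {R : realType}.

Lemma integral_torus_prod (u v : R -> R) :
  continuous u -> continuous v ->
  (forall t, 0 <= u t) -> (forall t, 0 <= v t) ->
  (\int[lebesgue2 R]_(x in @torus R) (u x.1 * v x.2)%:E =
   \int[lebesgue_measure]_(t in `[(- pi)%R, pi]) (u t)%:E *
   \int[lebesgue_measure]_(t in `[(- pi)%R, pi]) (v t)%:E)%E.
Proof.
move=> cu cv u0 v0; pose I : set R := `[- pi, pi]%classic.
have mI : measurable I by exact: measurable_itv.
have mr (w : R -> R) : continuous w -> measurable_fun setT ((EFin \o w) \_ I).
  move=> cw; apply/(measurable_restrictT _ mI)/measurable_EFinP.
  by apply: measurable_funTS; exact: continuous_measurable_fun.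
have r0 (w : R -> R) t : (forall t, 0 <= w t) -> (0 <= ((EFin \o w) \_ I) t)%E.
  by move=> w0; rewrite patchE; case: ifP => // _; rewrite lee_fin.
rewrite integral_mkcond (_ : _ \_ _ = (fun x : R * R =>
    ((EFin \o u) \_ I) x.1 * ((EFin \o v) \_ I) x.2)%E); last first.
  apply/funext => -[x y]; rewrite !patchE/= in_setX.
  by case: (x \in _); case: (y \in _) => //=; rewrite ?EFinM ?mul0e ?mule0.
rewrite fubini_tonelli1/=; last 2 first.
- apply: emeasurable_funM; apply: measurableT_comp => //; exact: mr.
- by move=> x; rewrite mule_ge0// r0.
under eq_integral => x _.
  rewrite /fubini_F/= ge0_integralZl//;
    [|exact: mr|by move=> y _; exact: r0|exact: r0].
  over.
rewrite ge0_integralZr//; [|exact: mr|by move=> y _; exact: r0|].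
  by rewrite -!integral_mkcond.
by apply: integral_ge0 => y _; exact: r0.
Qed.

Lemma integral_torus_poisson (a b : R[i]) : disc a -> disc b ->
  (\int[lebesgue2 R]_(x in @torus R)
    (poisson_kernel a x.1 * poisson_kernel b x.2)%:E =
   ((2 * pi) ^+ 2)%:E)%E.
Proof.
move=> a1 b1; rewrite integral_torus_prod; last 4 first.
- exact: continuous_poisson.
- exact: continuous_poisson.
- by move=> t; exact: poisson_ge0.
- by move=> t; exact: poisson_ge0.
by rewrite !integral_poisson// -EFinM expr2.
Qed.

(** Dominated convergence: the truncated squares tend to 0 pointwise and are
    dominated by [N ^+ 2]. *)
Lemma integral_tail_lt (N : R * R -> R) (e : R) : measurable_fun setT N ->
  (forall x, 0 <= N x) ->
  (\int[lebesgue2 R]_(x in @torus R) ((N x) ^+ 2)%:E < +oo)%E -> 0 < e ->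
  exists2 n : nat, 0 < n%:R :> R &
  (\int[lebesgue2 R]_(x in @torus R)
    (if n%:R < N x then (N x) ^+ 2 else 0)%:E < e%:E)%E.
Proof.
move=> mN N0 N2oo e0.
pose f n (x : R * R) : \bar R := (if n%:R < N x then (N x) ^+ 2 else 0)%:E.
have mN2 : measurable_fun (@torus R) (fun x => ((N x) ^+ 2)%:E).
  by apply: measurable_funTS; apply/measurable_EFinP; apply: measurable_funX.
have mf n : measurable_fun (@torus R) (f n).
  apply: measurable_funTS; apply/measurable_EFinP.
  apply: measurable_fun_if => //.
  - exact: measurable_fun_ltr.
  - by apply: measurable_funTS; apply: measurable_funX.
have cf : {ae lebesgue2 R, forall x, torus x -> f n x @[n --> \oo] --> 0%E}.
  apply: aeW => x _; apply: cvg_near_cst; near=> n.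
  by rewrite /f ltNge ifF//; apply/negbF; near: n; exact: nbhs_infty_ger.
have iN2 : (lebesgue2 R).-integrable (@torus R) (fun x => ((N x) ^+ 2)%:E).
  apply/integrableP; split => //.
  under eq_integral do rewrite gee0_abs ?lee_fin ?sqr_ge0//.
  exact: N2oo.
have fN2 : {ae lebesgue2 R,
    forall x n, torus x -> (`|f n x| <= ((N x) ^+ 2)%:E)%E}.
  apply: aeW => x n _; rewrite /f; case: ifP => _.
    by rewrite gee0_abs ?lee_fin ?sqr_ge0.
  by rewrite abse0 lee_fin sqr_ge0.
have [_ _] := @dominated_convergence _ _ _ (lebesgue2 R) (@torus R)
  measurable_torus f (cst 0%E) (fun x => ((N x) ^+ 2)%:E) mf
  (measurable_cst _) cf iN2 fN2.
rewrite integral0 => /fine_cvgP[ffin /cvgrPdist_lt/(_ e e0) fe].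
near \oo => n; exists n; first by rewrite ltr0n; near: n; exact: nbhs_infty_gt.
have := near ffin n; have := near fe n.
rewrite /= sub0r normrN => fen /(_ _)/fineK <-; last by [].
by rewrite lte_fin (le_lt_trans (ler_norm _))// fen.
Unshelve. all: by end_near. Qed.
End TorusIntegral.

(** * Decay of the pairing with a square integrable function *)

Section Decay.
Context {R : realType}.
Implicit Types (a b : R[i]).

Definition kernel_norm a b (x : R * R) : R :=
  normc (szego a (expi x.1)) * normc (szego b (expi x.2)).

Lemma kernel_norm_ge0 a b x : 0 <= kernel_norm a b x.
Proof. by rewrite mulr_ge0 ?normc_ge0. Qed.

Lemma measurable_fst_snd (u v : R -> R) : continuous u -> continuous v ->
  measurable_fun setT (fun x : R * R => u x.1 * v x.2).
Proof.
move=> cu cv; apply: continuous_measurable_fun2 => x.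
by apply: cvgM; [apply: continuous_comp (cu _); exact: cvg_fst
  |apply: continuous_comp (cv _); exact: cvg_snd].
Qed.

Lemma integral_1poisson a : disc a ->
  (\int[lebesgue_measure]_(t in `[(- pi)%R, pi]) (1 + poisson_kernel a t)%:E =
   (4 * pi)%:E)%E.
Proof.
move=> a1; under eq_integral do rewrite EFinD.
rewrite ge0_integralD//; last 2 first.
- by move=> t _; rewrite lee_fin poisson_ge0.
- apply: measurable_funTS; apply/measurable_EFinP.
  by apply: continuous_measurable_fun; exact: continuous_poisson.
rewrite integral_poisson// integral_cst//= lebesgue_measure_itv/=.
rewrite lte_fin gtrN ?pi_gt0// mul1e -!EFinD; congr _%:E; ring.
Qed.

Lemma integral_1poisson2 a a' : disc a -> disc a' ->
  (\int[lebesgue_measure]_(t in `[(- pi)%R, pi])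
    (1 + poisson_kernel a t + poisson_kernel a' t)%:E = (6 * pi)%:E)%E.
Proof.
move=> a1 a'1; under eq_integral do rewrite EFinD.
have mp c : disc c ->
    measurable_fun (`[(- pi)%R, pi]%classic : set R) (poisson_kernel c).
  move=> c1; apply: measurable_funTS.
  by apply: continuous_measurable_fun; exact: continuous_poisson.
rewrite ge0_integralD//; last 4 first.
- by move=> t _; rewrite lee_fin addr_ge0 ?poisson_ge0.
- by apply/measurable_EFinP; apply: measurable_funD => //; exact: mp.
- by move=> t _; rewrite lee_fin poisson_ge0.
- by apply/measurable_EFinP; exact: mp.
rewrite integral_1poisson// integral_poisson// -EFinD; congr _%:E; ring.
Qed.

(** The majorant [U] has an integral that does not depend on the parameters, so
    this bounds the integral of [kernel_norm a b] by a multiple of [e]. *)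
Lemma kernel_norm_small (e : R) : 0 < e <= 1 -> exists2 r : R, r < 1 &
  forall a b, disc a -> disc b -> r < normc a \/ r < normc b ->
  exists U : R * R -> R, [/\ measurable_fun setT U, forall x, 0 <= U x,
    (\int[lebesgue2 R]_(x in @torus R) (U x)%:E = (6 * (2 * pi) ^+ 2)%:E)%E &
    forall x, kernel_norm a b x <= e * U x].
Proof.
move=> e01; have [r r1 rP] := normc_szego_small e e01; exists r => // a b a1 b1.
have e0 : 0 <= e by case/andP: e01 => /ltW.
have c1 (c : R[i]) : disc c -> continuous (fun t => 1 + poisson_kernel c t).
  by move=> ? t; apply: cvgD; [exact: cvg_cst|exact: continuous_poisson].
have c2 (c c' : R[i]) : disc c -> disc c' ->
    continuous (fun t => 1 + poisson_kernel c t + poisson_kernel c' t).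
  by move=> ? ? t; apply: cvgD; [exact: c1|exact: continuous_poisson].
have p1 (c : R[i]) (t : R) : disc c -> 0 <= 1 + poisson_kernel c t.
  by move=> ?; rewrite addr_ge0 ?poisson_ge0.
have p2 (c c' : R[i]) (t : R) : disc c -> disc c' ->
    0 <= 1 + poisson_kernel c t + poisson_kernel c' t.
  by move=> ? ?; rewrite addr_ge0 ?p1 ?poisson_ge0.
case=> [/(rP _ a1)[a' a'1 aP]|/(rP _ b1)[b' b'1 bP]].
  exists (fun x => (1 + poisson_kernel a x.1 + poisson_kernel a' x.1) *
    (1 + poisson_kernel b x.2)).
  split.
  - exact: measurable_fst_snd _ _ (c2 _ _ a1 a'1) (c1 _ b1).
  - by move=> x; rewrite mulr_ge0 ?p1 ?p2.
  - rewrite (integral_torus_prod _ _ (c2 _ _ a1 a'1) (c1 _ b1)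
      (fun t => p2 _ _ t a1 a'1) (fun t => p1 _ t b1)).
    rewrite integral_1poisson// integral_1poisson2// -EFinM; congr _%:E; ring.
  - move=> x; rewrite mulrA ler_pM ?normc_ge0//; exact: normc_szego_le.
exists (fun x => (1 + poisson_kernel a x.1) *
  (1 + poisson_kernel b x.2 + poisson_kernel b' x.2)).
split.
- exact: measurable_fst_snd _ _ (c1 _ a1) (c2 _ _ b1 b'1).
- by move=> x; rewrite mulr_ge0 ?p1 ?p2.
- rewrite (integral_torus_prod _ _ (c1 _ a1) (c2 _ _ b1 b'1)
    (fun t => p1 _ t a1) (fun t => p2 _ _ t b1 b'1)).
  rewrite integral_1poisson// integral_1poisson2// -EFinM; congr _%:E; ring.
- move=> x; rewrite mulrCA ler_pM ?normc_ge0//; exact: normc_szego_le.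
Qed.

Lemma kernel_norm_sqr a b x : disc a -> disc b ->
  kernel_norm a b x ^+ 2 = poisson_kernel a x.1 * poisson_kernel b x.2.
Proof. by move=> a1 b1; rewrite exprMn !sqr_normc_szego. Qed.

Lemma continuous_normc_szego a : disc a ->
  continuous (fun t : R => normc (szego a (expi t))).
Proof.
move=> a1 t; rewrite (_ : (fun u => _) = Num.sqrt \o poisson_kernel a).
  by apply: continuous_comp; [exact: continuous_poisson|exact: sqrt_continuous].
apply/funext => u /=; rewrite -sqr_normc_szego// sqrtr_sqr ger0_norm//.
exact: normc_ge0.
Qed.

Lemma measurable_kernel_norm a b : disc a -> disc b ->
  measurable_fun setT (kernel_norm a b).
Proof.
move=> a1 b1; exact: (measurable_fst_snd _ _
  (continuous_normc_szego _ a1) (continuous_normc_szego _ b1)).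
Qed.

(** Where [N] exceeds a large constant [M], the inequality between arithmetic and
    geometric means splits [N * K] into a multiple of the tail of [N ^+ 2] and a
    small multiple of [K ^+ 2], whose integral is fixed; elsewhere [N * K] is at
    most [M * K], and [K] is small in the mean. *)
Lemma integral_kernel_small (N : R * R -> R) (e : R) : measurable_fun setT N ->
  (forall x, 0 <= N x) ->
  (\int[lebesgue2 R]_(x in @torus R) ((N x) ^+ 2)%:E < +oo)%E -> 0 < e ->
  exists2 r : R, r < 1 &
  forall a b, disc a -> disc b -> r < normc a \/ r < normc b ->
  (\int[lebesgue2 R]_(x in @torus R) (N x * kernel_norm a b x)%:E <= e%:E)%E.
Proof.
move=> mN N0 N2oo e0; pose A : R := (2 * pi) ^+ 2.
have A0 : 0 < A by rewrite exprn_gt0// mulr_gt0// pi_gt0.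
(* The weight in the arithmetic-geometric mean inequality: with it the term in
   [K ^+ 2] contributes [e / 3]. *)
have [h hE] : exists h, h = 2 * e / (3 * A) by eexists.
have h0 : 0 < h by rewrite hE divr_gt0// mulr_gt0.
have t0 : 0 < 2 * h * e / 3 by rewrite divr_gt0// !mulr_gt0.
have [n n0 nP] := integral_tail_lt N _ mN N0 N2oo t0.
pose M : R := n%:R. have Mp : 0 < M by [].
have [d /andP[d0 d1] dM] : exists2 d : R, 0 < d <= 1 & M * d * (6 * A) <= e / 3.
  have MA0 : 0 < 18 * M * A by apply: mulr_gt0 => //; exact: mulr_gt0.
  have y0 : 0 < e / (18 * M * A) by exact: divr_gt0.
  exists (Num.min 1 (e / (18 * M * A))).
    by rewrite lt_min ltr01 y0 ge_min lexx.
  apply: (@le_trans _ _ (M * (e / (18 * M * A)) * (6 * A))).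
    rewrite ler_pM2r; last exact: mulr_gt0.
    by rewrite ler_pM2l// ge_min lexx orbT.
  rewrite le_eqVlt; apply/orP; left; apply/eqP; field.
  by rewrite !gt_eqF.
have [r r1 rP] := kernel_norm_small d (introT andP (conj d0 d1)).
exists r => // a b a1 b1 /(rP _ _ a1 b1)[U [mU U0 iU UP]].
pose W x : R := if M < N x then (N x) ^+ 2 else 0.
have W0 x : 0 <= W x by rewrite /W; case: ifP; rewrite ?sqr_ge0.
have mW : measurable_fun setT W.
  apply: measurable_fun_if => //; first exact: measurable_fun_ltr.
  by apply: measurable_funTS; apply: measurable_funX.
have mK := measurable_kernel_norm a b a1 b1.
have mE (f : R * R -> R) : measurable_fun setT f ->
    measurable_fun (@torus R) (EFin \o f).
  by move=> mf; apply: measurable_funTS; apply/measurable_EFinP.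
have M0 : 0 <= M by exact: ler0n.
have split x : N x * kernel_norm a b x <=
    (2 * h)^-1 * W x + (h / 2) * (kernel_norm a b x ^+ 2) + (M * d) * U x.
  have K0 := kernel_norm_ge0 a b x; have Kd := UP x.
  set K := kernel_norm a b x in K0 Kd *.
  have Mk : M * K <= M * d * U x by rewrite -mulrA ler_wpM2l.
  rewrite /W; case: ltP => [_|NM].
    have -> : (2 * h)^-1 * N x ^+ 2 + h / 2 * K ^+ 2 =
      N x * K + (N x - h * K) ^+ 2 / (2 * h) by field; rewrite gt_eqF.
    rewrite -addrA lerDl addr_ge0 ?divr_ge0 ?sqr_ge0 ?mulr_ge0 ?(ltW h0)//.
    exact: ltW.
  rewrite mulr0 add0r (le_trans (ler_wpM2r K0 NM))// (le_trans Mk)// lerDr.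
  by rewrite mulr_ge0 ?sqr_ge0// divr_ge0// ltW.
have mK2 : measurable_fun setT (fun x => kernel_norm a b x ^+ 2).
  exact: measurable_funX.
have m1 : measurable_fun (@torus R) (fun x => (W x)%:E) by exact: mE.
have m2 : measurable_fun (@torus R) (fun x => (kernel_norm a b x ^+ 2)%:E).
  by exact: mE.
have m3 : measurable_fun (@torus R) (fun x => (U x)%:E) by exact: mE.
have mT := @measurable_torus R.
have c1 : 0 <= (2 * h)^-1 by rewrite invr_ge0 mulr_ge0// ltW.
have c2 : 0 <= h / 2 by rewrite divr_ge0// ltW.
have c3 : 0 <= M * d by rewrite mulr_ge0// ltW.
apply: (@le_trans _ _ (\int[lebesgue2 R]_(x in @torus R)
    (((2 * h)^-1)%:E * (W x)%:E + (h / 2)%:E * (kernel_norm a b x ^+ 2)%:E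
     + (M * d)%:E * (U x)%:E))%E).
  apply: ge0_le_integral => //.
  - by move=> x _; rewrite lee_fin mulr_ge0 ?kernel_norm_ge0.
  - by apply: mE; exact: measurable_funM.
  - apply: emeasurable_funD; last exact: emeasurable_funM.
    by apply: emeasurable_funD; exact: emeasurable_funM.
  - by move=> x _; rewrite -!EFinM -!EFinD lee_fin.
rewrite ge0_integralD//; last 4 first.
- by move=> x _; rewrite -!EFinM -EFinD lee_fin addr_ge0// mulr_ge0// sqr_ge0.
- by apply: emeasurable_funD; exact: emeasurable_funM.
- by move=> x _; rewrite -EFinM lee_fin mulr_ge0.
- exact: emeasurable_funM.
rewrite ge0_integralD//; last 4 first.
- by move=> x _; rewrite -EFinM lee_fin mulr_ge0.
- exact: emeasurable_funM.
- by move=> x _; rewrite -EFinM lee_fin mulr_ge0// sqr_ge0.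
- exact: emeasurable_funM.
rewrite !ge0_integralZl//; last 3 first.
- by move=> x _; rewrite lee_fin.
- by move=> x _; rewrite lee_fin sqr_ge0.
- by move=> x _; rewrite lee_fin.
under [in X in (_ + (h / 2)%:E * X + _)%E]eq_integral do
  rewrite kernel_norm_sqr//.
rewrite integral_torus_poisson// iU -!EFinM.
have -> : e = e / 3 + e / 3 + e / 3 by field.
rewrite !EFinD leeD//.
rewrite leeD//.
  have -> : e / 3 = (2 * h)^-1 * (2 * h * e / 3) by field; rewrite gt_eqF.
  by rewrite EFinM lee_wpmul2l ?lee_fin// ltW.
rewrite lee_fin le_eqVlt -/A hE; apply/orP; left; apply/eqP; field.
by rewrite gt_eqF.
Qed.
End Decay.

(** * Complex-valued integrals over the torus *)

Section ComplexIntegral.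
Context {R : realType}.
Implicit Types (h : R * R -> R[i]).

Definition measurable_complex h :=
  measurable_fun setT (fun x => complex.Re (h x)) /\
  measurable_fun setT (fun x => complex.Im (h x)).

Lemma integrable_parts h : measurable_complex h ->
  (\int[lebesgue2 R]_(x in @torus R) (normc (h x))%:E < +oo)%E ->
  (lebesgue2 R).-integrable (@torus R) (fun x => (complex.Re (h x))%:E) /\
  (lebesgue2 R).-integrable (@torus R) (fun x => (complex.Im (h x))%:E).
Proof.
move=> [mr mi] hoo; have mN := measurable_normc _ mr mi.
have part (f : R * R -> R) : measurable_fun setT f ->
    (forall x, `|f x| <= normc (h x)) ->
    (lebesgue2 R).-integrable (@torus R) (EFin \o f).
  move=> mf fh; have mf' : measurable_fun (@torus R) (EFin \o f).
    by apply: measurable_funTS; apply/measurable_EFinP.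
  apply/integrableP; split => //; apply: le_lt_trans hoo.
  apply: ge0_le_integral => //.
  - exact: measurable_torus.
  - by apply: measurableT_comp.
  - by apply: measurable_funTS; apply/measurable_EFinP.
  - by move=> x _; rewrite lee_fin fh.
by split; apply: part => // x; [exact: Re_le_normc|exact: Im_le_normc].
Qed.

Lemma normc_integral_torus_le h (B : R) : measurable_complex h ->
  (\int[lebesgue2 R]_(x in @torus R) (normc (h x))%:E <= B%:E)%E ->
  normc (integral_torus h) <= 2 * B.
Proof.
move=> mh hB; have hoo := le_lt_trans hB (ltry B).
have [ir ii] := integrable_parts _ mh hoo.
have [mr mi] := mh.
have part (f : R * R -> R) : (lebesgue2 R).-integrable (@torus R) (EFin \o f) ->
    (forall x, `|f x| <= normc (h x)) ->
    `|Rintegral (lebesgue2 R) (@torus R) f| <= B.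
  move=> intf fh; rewrite -lee_fin EFin_normr_Rintegral//;
    last exact: measurable_torus.
  apply: le_trans hB; apply: le_trans (le_abse_integral _ _ _) _ => //.
  - exact: measurable_torus.
  - by have /integrableP[] := intf.
  apply: ge0_le_integral => //.
  - exact: measurable_torus.
  - by apply: measurableT_comp => //; have /integrableP[] := intf.
  - by apply: measurable_funTS; apply/measurable_EFinP; exact: measurable_normc.
  - by move=> x _; rewrite lee_fin fh.
apply: le_trans (normc_le_ReIm _) _; rewrite mulr2n mulrDl mul1r lerD//=.
  by apply: part => // x; exact: Re_le_normc.
by apply: part => // x; exact: Im_le_normc.
Qed.

Lemma integral_torusB h1 h2 : measurable_complex h1 -> measurable_complex h2 ->
  (\int[lebesgue2 R]_(x in @torus R) (normc (h1 x))%:E < +oo)%E ->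
  (\int[lebesgue2 R]_(x in @torus R) (normc (h2 x))%:E < +oo)%E ->
  integral_torus h1 - integral_torus h2 = integral_torus (fun x => h1 x - h2 x).
Proof.
move=> m1 m2 f1 f2.
have [r1 i1] := integrable_parts _ m1 f1.
have [r2 i2] := integrable_parts _ m2 f2.
have mT := @measurable_torus R.
rewrite /integral_torus; apply/eqP; rewrite eq_complex/=.
apply/andP; split; apply/eqP.
  rewrite -RintegralB//; apply: eq_Rintegral => x _; by rewrite raddfB.
rewrite -RintegralB//; apply: eq_Rintegral => x _; by rewrite raddfB.
Qed.

Lemma measurable_complexB h1 h2 : measurable_complex h1 ->
  measurable_complex h2 -> measurable_complex (fun x => h1 x - h2 x).
Proof.
move=> [r1 i1] [r2 i2]; split.
  by under eq_fun do rewrite raddfB; exact: measurable_funB.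
by under eq_fun do rewrite raddfB; exact: measurable_funB.
Qed.

Lemma measurable_complex_mul_conj h1 h2 : measurable_complex h1 ->
  measurable_complex h2 -> measurable_complex (fun x => h1 x * (h2 x)^*).
Proof.
move=> [r1 i1] [r2 i2]; split.
  rewrite (_ : (fun x => _) = (fun x => complex.Re (h1 x) * complex.Re (h2 x)
      + complex.Im (h1 x) * complex.Im (h2 x))).
    by apply: measurable_funD; exact: measurable_funM.
  apply/funext => x; case: (h1 x) (h2 x) => [u v] [w z] /=.
  by rewrite mulrN opprK.
rewrite (_ : (fun x => _) = (fun x => complex.Im (h1 x) * complex.Re (h2 x)
    - complex.Re (h1 x) * complex.Im (h2 x))).
  by apply: measurable_funB; exact: measurable_funM.
apply/funext => x; case: (h1 x) (h2 x) => [u v] [w z] /=.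
by rewrite mulrN addrC.
Qed.

Lemma continuous_measurable_complex h : continuous h -> measurable_complex h.
Proof.
move=> ch; split; apply: continuous_measurable_fun2 => x.
  by apply: cvg_Re; exact: ch.
by apply: cvg_Im; exact: ch.
Qed.
End ComplexIntegral.

(** * Dependence of the Szego kernel on its parameter *)

Section SzegoKernel.
Context {R : realType}.
Implicit Types (a b z : R[i]).

Definition szego_torus a b (x : R * R) : R[i] :=
  szego a (expi x.1) * szego b (expi x.2).

Lemma szegoE a z : disc a ->
  szego a z = (Num.sqrt (1 - normc a ^+ 2))%:C%C / (1 - a^* * z).
Proof.
move=> a1; rewrite /szego; congr (_ / _).
rewrite normr_normc -(rmorph1 (real_complex R)) -rmorphXn -rmorphB.
have a0 : 0 <= 1 - normc a ^+ 2 by rewrite subr_ge0 ltW// sqr_normc_lt1.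
by rewrite -{1}(sqr_sqrtr a0) rmorphXn sqrCK// ler0c sqrtr_ge0.
Qed.

Lemma continuous_szego a (t : R) : disc a -> {for expi t, continuous (szego a)}.
Proof.
move=> a1; pose u (z : R[i]) : R[i] := 1 - a^* * z.
have u0 : u (expi t) != 0.
  have := sub1_conj_gt0 a t a1; apply: contraTneq; rewrite /u => ->.
  by rewrite normc0 ltxx.
have cu : {for expi t, continuous u}.
  apply: (proj2 (cvg_complexP _ (nbhs (expi t)) (nbhs_filter _) u _)) => e e0.
  apply/nbhs_complexP; exists e => // z; apply: le_lt_trans.
  rewrite /u opprB addrC subrKA -mulrBr normcM normc_conj normcBC.
  by rewrite ler_piMl ?normc_ge0 ?ltW// -discE.
have cuV : {for expi t, continuous (fun z => (u z)^-1)}.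
  exact: (@cvgV _ _ (nbhs (expi t)) (nbhs_filter _) u _ u0 cu).
exact: (@cvgMl_tmp _ _ (nbhs (expi t)) (nbhs_filter _) _ _ _ cuV).
Qed.

Lemma boundary_value_szego a b (x : R * R) : disc a -> disc b ->
  boundary_value (tensor (szego a) (szego b)) x = szego_torus a b x.
Proof.
move=> a1 b1; apply: (cvg_lim (@norm_hausdorff _ _)).
have cf : tensor (szego a) (szego b) p @[p --> (expi x.1, expi x.2)] -->
    szego_torus a b x.
  apply: (@cvgM _ _ (nbhs (expi x.1, expi x.2)) (nbhs_filter _)
      (fun p => szego a p.1) (fun p => szego b p.2)).
    exact: (cvg_comp fst (szego a) cvg_fst (continuous_szego a x.1 a1)).
  exact: (cvg_comp snd (szego b) cvg_snd (continuous_szego b x.2 b1)).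
exact: cvg_comp (nbhs_nontangential _ _) cf.
Qed.

Lemma continuous_szego_torus a b : disc a -> disc b ->
  continuous (szego_torus a b).
Proof.
move=> a1 b1 x.
have ce (pr : R * R -> R) : {for x, continuous pr} ->
    {for x, continuous (fun y => expi (pr y))}.
  by move=> cpr; apply: continuous_comp => //; exact: continuous_expi.
apply: (@cvgM _ _ (nbhs x) (nbhs_filter _)
    (fun y => szego a (expi y.1)) (fun y => szego b (expi y.2))).
  exact: (cvg_comp _ (szego a) (ce _ cvg_fst) (continuous_szego a x.1 a1)).
exact: (cvg_comp _ (szego b) (ce _ cvg_snd) (continuous_szego b x.2 b1)).
Qed.

Lemma normc_szego_torus a b x : normc (szego_torus a b x) = kernel_norm a b x.
Proof. exact: normcM. Qed.

(** A bound, uniform on the circle, for the difference of the kernels at [a] and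
    [a'], see [normc_szego_sub_le]. *)
Definition szego_modulus a a' : R :=
  `|Num.sqrt (1 - normc a ^+ 2) - Num.sqrt (1 - normc a' ^+ 2)| / (1 - normc a)
  + normc (a - a') / ((1 - normc a) * (1 - normc a')).

Lemma normc_inv_sub1_le a t : disc a ->
  normc (1 - a^* * expi t)^-1 <= (1 - normc a)^-1.
Proof.
move=> a1; rewrite normcV lef_pV2 ?posrE ?subr_gt0 -?discE//.
  exact: sub1_conj_ge.
exact: sub1_conj_gt0.
Qed.

Lemma normc_szego_sub_le a a' (t : R) : disc a -> disc a' ->
  normc (szego a (expi t) - szego a' (expi t)) <= szego_modulus a a'.
Proof.
move=> a1 a'1; rewrite !szegoE//.
set s := Num.sqrt _; set s' := Num.sqrt _.
pose u := 1 - a^* * expi t; pose u' := 1 - a'^* * expi t.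
have n0 (c : R[i]) : disc c -> 1 - c^* * expi t != 0.
  move=> c1; have := sub1_conj_gt0 c t c1; apply: contraTneq => ->.
  by rewrite normc0 ltxx.
have -> : s%:C%C / u - s'%:C%C / u' =
    (s - s')%:C%C * u^-1 + s'%:C%C * ((a - a')^* * expi t * (u^-1 * u'^-1)).
  have -> : (a - a')^* * expi t = u' - u.
    by rewrite rmorphB mulrBl /u /u' opprB [RHS]addrC subrKA.
  by rewrite rmorphB; field; rewrite !n0.
apply: le_trans (normcD_le _ _) _; rewrite lerD//.
  by rewrite normcM normc_real ler_wpM2l// normc_inv_sub1_le.
rewrite 4!normcM normc_conj normc_expi mulr1 normc_real invfM -[leRHS]mul1r.
rewrite ler_pM ?mulr_ge0 ?normc_ge0//.
  by rewrite ger0_norm ?sqrtr_ge0// -[leRHS]sqrtr1 ler_wsqrtr// gerBl sqr_ge0.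
rewrite ler_wpM2l ?normc_ge0// ler_pM ?normc_ge0//; exact: normc_inv_sub1_le.
Qed.

Lemma normc_szego_le_inv a (t : R) : disc a ->
  normc (szego a (expi t)) <= (1 - normc a)^-1.
Proof.
move=> a1; rewrite szegoE// normcM normc_real.
rewrite -[leRHS]mul1r ler_pM ?normc_ge0 ?normc_inv_sub1_le//.
by rewrite ger0_norm ?sqrtr_ge0// -[leRHS]sqrtr1 ler_wsqrtr// gerBl sqr_ge0.
Qed.

End SzegoKernel.

(** * The coefficient as a function of the parameters *)

Section Coefficient.
Context {R : realType}.
Context (g : R[i] * R[i] -> R[i]) (hg : hardy2 g).
Implicit Types (a b : R[i]).

Let N (x : R * R) := normc (boundary_value g x).
Let c0 : R := (4 * pi ^+ 2)^-1.

Let c0_gt0 : 0 < c0.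
Proof. by rewrite invr_gt0 mulr_gt0// exprn_gt0// pi_gt0. Qed.

Definition szego_integrand a b x := boundary_value g x * (szego_torus a b x)^*.

Definition szego_coef a b := normc (inner g (tensor (szego a) (szego b))).

Lemma inner_szegoE a b : disc a -> disc b ->
  inner g (tensor (szego a) (szego b)) =
  ((4 * pi ^+ 2)^-1)%:C%C * integral_torus (szego_integrand a b).
Proof.
move=> a1 b1; congr (_ * integral_torus _); apply/funext => x.
by rewrite boundary_value_szego.
Qed.

Lemma measurable_complex_boundary_value : measurable_complex (boundary_value g).
Proof. by have [g_holo _] := hg; exact: measurable_boundary_value. Qed.

Let mN : measurable_fun setT N.
Proof.
have [? ?] := measurable_complex_boundary_value; exact: measurable_normc.
Qed.

Lemma measurable_szego_integrand a b : disc a -> disc b ->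
  measurable_complex (szego_integrand a b).
Proof.
move=> a1 b1.
apply: (measurable_complex_mul_conj _ _ measurable_complex_boundary_value).
by apply: continuous_measurable_complex; exact: continuous_szego_torus.
Qed.

Lemma boundary_value_integrable : exists2 B : R, 0 <= B &
  (\int[lebesgue2 R]_(x in @torus R) (normc (boundary_value g x))%:E
    <= B%:E)%E.
Proof.
have h : (\int[lebesgue2 R]_(x in @torus R) (N x)%:E < +oo)%E.
  apply: (@le_lt_trans _ _ (\int[lebesgue2 R]_(x in @torus R)
      (1%:E + (N x ^+ 2)%:E))%E).
    apply: ge0_le_integral => //.
    - exact: measurable_torus.
    - by move=> x _; rewrite lee_fin normc_ge0.
    - by apply: measurable_funTS; apply/measurable_EFinP.
    - apply: measurable_funTS; apply: emeasurable_funD => //.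
      by apply/measurable_EFinP; exact: measurable_funX.
    - move=> x _; rewrite -EFinD lee_fin; set n := N x.
      have := sqr_ge0 (n - 1); have := normc_ge0 (boundary_value g x).
      by rewrite -/n; nra.
  rewrite ge0_integralD//; last 3 first.
  - exact: measurable_torus.
  - by move=> x _; rewrite lee_fin sqr_ge0.
  - by apply: measurable_funTS; apply/measurable_EFinP; exact: measurable_funX.
  rewrite integral_cst; last exact: measurable_torus.
  rewrite lte_add_pinfty//; last exact: boundary_value_square_integrable.
  by rewrite [X in (1 * X)%E]lebesgue2_torus mul1e ltry.
have i0 : (0 <= \int[lebesgue2 R]_(x in @torus R) (N x)%:E)%E.
  by apply: integral_ge0 => x _; rewrite lee_fin normc_ge0.
exists (fine (\int[lebesgue2 R]_(x in @torus R) (N x)%:E)%E).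
  exact: fine_ge0.
by rewrite fineK// ge0_fin_numE.
Qed.

Lemma szego_coef_small (e : R) : 0 < e -> exists2 r : R, r < 1 &
  forall a b, disc a -> disc b -> r < normc a \/ r < normc b ->
  szego_coef a b <= e.
Proof.
move=> e0; have d0 : 0 < e / (2 * c0) by rewrite divr_gt0// mulr_gt0.
have N0 x : 0 <= N x by exact: normc_ge0.
have [r r1 rP] := integral_kernel_small N _ mN N0
  (boundary_value_square_integrable _ hg) d0.
exists r => // a b a1 b1 rab.
rewrite /szego_coef inner_szegoE// normcM normc_real.
rewrite gtr0_norm// mulrC -ler_pdivlMr//.
have -> : e / c0 = 2 * (e / (2 * c0)) by field; rewrite gt_eqF.
apply: normc_integral_torus_le; first exact: measurable_szego_integrand.
under eq_integral => x _.
  rewrite /szego_integrand normcM normc_conj normc_szego_torus; over.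
exact: rP.
Qed.

Lemma normc_integrand_le (k : R * R -> R[i]) (M B : R) :
  measurable_complex k -> (forall x, normc (k x) <= M) ->
  (\int[lebesgue2 R]_(x in @torus R) (normc (boundary_value g x))%:E
    <= B%:E)%E ->
  (\int[lebesgue2 R]_(x in @torus R) (normc (boundary_value g x * (k x)^*))%:E
    <= (M * B)%:E)%E.
Proof.
move=> mk kM NB.
have M0 : 0 <= M by apply: le_trans (kM (0, 0)); exact: normc_ge0.
apply: (@le_trans _ _ (\int[lebesgue2 R]_(x in @torus R) (M%:E * (N x)%:E))%E).
  apply: ge0_le_integral => //.
  - exact: measurable_torus.
  - by move=> x _; rewrite lee_fin normc_ge0.
  - apply: measurable_funTS; apply/measurable_EFinP.
    have [mr mi] :=
      measurable_complex_mul_conj _ _ measurable_complex_boundary_value mk.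
    exact: measurable_normc.
  - apply: measurable_funTS; apply: emeasurable_funM => //.
    exact/measurable_EFinP.
  - move=> x _; rewrite -EFinM lee_fin normcM normc_conj mulrC.
    by rewrite ler_wpM2r ?normc_ge0.
rewrite ge0_integralZl//; first by rewrite EFinM lee_wpmul2l.
- exact: measurable_torus.
- by apply: measurable_funTS; exact/measurable_EFinP.
- by move=> x _; rewrite lee_fin normc_ge0.
Qed.

Lemma szego_coef_dist_le : exists2 C : R, 0 <= C &
  forall a b a' b', disc a -> disc b -> disc a' -> disc b' ->
  `|szego_coef a b - szego_coef a' b'| <=
  C * ((1 - normc a)^-1 * szego_modulus b b' +
       szego_modulus a a' * (1 - normc b')^-1).
Proof.
have [B B0 NB] := boundary_value_integrable.
exists (c0 * (2 * B)); first by rewrite !mulr_ge0// ltW.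
move=> a b a' b' a1 b1 a'1 b'1; set om := (X in _ * X).
have om_ge x : normc (szego_torus a b x - szego_torus a' b' x) <= om.
  rewrite /szego_torus.
  set u := szego a _; set v := szego b _.
  set u' := szego a' _; set v' := szego b' _.
  have -> : u * v - u' * v' = u * (v - v') + (u - u') * v' by ring.
  rewrite (le_trans (normcD_le _ _))// (normcM u (v - v')) (normcM (u - u') v').
  apply: lerD; apply: ler_pM; rewrite ?normc_ge0//.
  - exact: normc_szego_le_inv.
  - exact: normc_szego_sub_le.
  - exact: normc_szego_sub_le.
  - exact: normc_szego_le_inv.
have fin c d : disc c -> disc d ->
    (\int[lebesgue2 R]_(x in @torus R)
      (normc (szego_integrand c d x))%:E < +oo)%E.
  move=> c1 d1; pose M := (1 - normc c)^-1 * (1 - normc d)^-1.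
  apply: le_lt_trans (ltry (M * B)); apply: normc_integrand_le (M) _ _ _ NB.
  - exact: continuous_measurable_complex (continuous_szego_torus _ _ c1 d1).
  - by move=> x; rewrite normcM ler_pM ?normc_ge0 ?normc_szego_le_inv.
apply: le_trans (normc_dist _ _) _; rewrite !inner_szegoE// -mulrBr normcM.
rewrite normc_real gtr0_norm// -!mulrA ler_wpM2l ?(ltW c0_gt0)//.
rewrite integral_torusB; try exact: fin; try exact: measurable_szego_integrand.
apply: normc_integral_torus_le.
  by apply: measurable_complexB; exact: measurable_szego_integrand.
under eq_integral => x _.
  rewrite /szego_integrand -mulrBr -rmorphB; over.
rewrite mulrC; apply: (normc_integrand_le
  (fun x => szego_torus a b x - szego_torus a' b' x)) NB => //.
by apply: measurable_complexB; apply: continuous_measurable_complex;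
  exact: continuous_szego_torus.
Qed.

End Coefficient.

(** * The maximum is attained *)

Section Attained.
Context {R : realType}.
Implicit Types (a b : R[i]) (v : (R * R) * (R * R)).

Lemma cvg_inv_sub1 (T : Type) (F : set_system T) (FF : Filter F)
    (f : T -> R[i]) a : disc a -> f @ F --> a ->
  (1 - normc (f x))^-1 @[x --> F] --> (1 - normc a)^-1.
Proof.
move=> a1 fa; apply: cvgV; first by rewrite gt_eqF// subr_gt0 -discE.
by apply: cvgB; [exact: cvg_cst|exact: cvg_normc].
Qed.

Lemma cvg_szego_modulus (T : Type) (F : set_system T) (FF : Filter F)
    (f : T -> R[i]) a : disc a -> f @ F --> a ->
  szego_modulus a (f x) @[x --> F] --> 0.
Proof.
move=> a1 fa; rewrite /szego_modulus.
have na := cvg_normc _ F FF _ _ fa.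
have -> : 0 = `|Num.sqrt (1 - normc a ^+ 2) - Num.sqrt (1 - normc a ^+ 2)|
    * (1 - normc a)^-1 + normc (a - a) * ((1 - normc a)^-1 * (1 - normc a)^-1).
  by rewrite !subrr normr0 normc0 !mul0r addr0.
apply: cvgD.
  have n2 : 1 - normc (f x) ^+ 2 @[x --> F] --> 1 - normc a ^+ 2.
    apply: cvgB; first exact: cvg_cst.
    exact: (cvg_comp _ (fun y => y ^+ 2) na (@exprn_continuous R 2 _)).
  apply: cvgMr_tmp; apply: cvg_norm; apply: cvgB; first exact: cvg_cst.
  exact: (cvg_comp _ Num.sqrt n2 (@sqrt_continuous R _)).
apply: cvgM.
  apply: cvg_normc; apply/cvg_complexP => e e0.
  have /cvg_complexP/(_ e e0) := fa; apply: filterS => x.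
  by rewrite subrr sub0r normcN.
under eq_fun do rewrite invfM.
by apply: cvgM; [exact: cvg_cst|exact: cvg_inv_sub1].
Qed.

(** Real coordinates, in which a closed polydisc becomes a closed and bounded
    subset of a product of four lines. *)
Definition complex_of (p : R * R) : R[i] := (p.1 +i* p.2)%C.

Lemma continuous_complex_of : continuous complex_of.
Proof.
by move=> p; apply: cvg_complex_parts; [exact: cvg_fst|exact: cvg_snd].
Qed.

Definition polydisc (r : R) : set ((R * R) * (R * R)) :=
  [set v | normc (complex_of v.1) <= r /\ normc (complex_of v.2) <= r].

Lemma continuous_complex_of_pair v :
  {for v, continuous (fun w => complex_of w.1)} /\
  {for v, continuous (fun w => complex_of w.2)}.
Proof.
split.
  exact: (cvg_comp fst complex_of cvg_fst (continuous_complex_of v.1)).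
exact: (cvg_comp snd complex_of cvg_snd (continuous_complex_of v.2)).
Qed.

Lemma continuous_normc_complex_of v :
  {for v, continuous (fun w => normc (complex_of w.1))} /\
  {for v, continuous (fun w => normc (complex_of w.2))}.
Proof.
have [c1 c2] := continuous_complex_of_pair v.
split; [exact: (cvg_normc _ (nbhs v) _ _ _ c1)|
        exact: (cvg_normc _ (nbhs v) _ _ _ c2)].
Qed.

Lemma compact_polydisc (r : R) : compact (polydisc r).
Proof.
pose I : set R := `[- r, r]%classic.
have cI : compact I by exact: segment_compact.
apply: (@subclosed_compact _ _ ((I `*` I) `*` (I `*` I))).
- rewrite (_ : polydisc r = ((fun v => normc (complex_of v.1)) @^-1`
    [set y | y <= r])
    `&` ((fun v => normc (complex_of v.2)) @^-1` [set y | y <= r]))//.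
  apply: closedI; apply: closed_comp; try exact: closed_le.
    by move=> v _; exact: (continuous_normc_complex_of v).1.
  by move=> v _; exact: (continuous_normc_complex_of v).2.
- by do 2!apply: compact_setX.
- have box (p : R * R) : normc (complex_of p) <= r -> (I `*` I) p.
    move=> pr; split; rewrite /I /= in_itv/= -ler_norml.
      exact: le_trans (Re_le_normc (complex_of p)) pr.
    exact: le_trans (Im_le_normc (complex_of p)) pr.
  by move=> v [/box ? /box ?].
Qed.

Lemma continuous_szego_coef (g : R[i] * R[i] -> R[i]) v : hardy2 g ->
  disc (complex_of v.1) -> disc (complex_of v.2) ->
  {for v, continuous (fun w => szego_coef g (complex_of w.1) (complex_of w.2))}.
Proof.
move=> hg v1 v2; have [C C0 CP] := szego_coef_dist_le _ hg.
have [c1 c2] := continuous_complex_of_pair v.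
have [n1 n2] := continuous_normc_complex_of v.
pose om (w : (R * R) * (R * R)) := C * ((1 - normc (complex_of v.1))^-1 *
    szego_modulus (complex_of v.2) (complex_of w.2) +
    szego_modulus (complex_of v.1) (complex_of w.1) *
    (1 - normc (complex_of w.2))^-1).
have om0 : om w @[w --> v] --> 0.
  have -> : 0 = C * ((1 - normc (complex_of v.1))^-1 * 0 +
    0 * (1 - normc (complex_of v.2))^-1) by rewrite mulr0 mul0r addr0 mulr0.
  apply: cvgMl_tmp; apply: cvgD.
    by apply: cvgMl_tmp; exact: cvg_szego_modulus v2 c2.
  apply: cvgM; first exact: cvg_szego_modulus v1 c1.
  exact: cvg_inv_sub1 v2 c2.
have nd : \forall w \near v, disc (complex_of w.1) /\ disc (complex_of w.2).
  rewrite !discE in v1 v2.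
  near=> w; rewrite !discE; split; near: w.
    exact: (cvgr_lt _ n1).
  exact: (cvgr_lt _ n2).
apply/cvgrPdist_lt => e e0; near=> w.
have [w1 w2] : disc (complex_of w.1) /\ disc (complex_of w.2) by near: w.
apply: le_lt_trans (CP _ _ _ _ v1 v2 w1 w2) _.
rewrite -/(om w); near: w; exact: (cvgr_lt _ om0).
Unshelve. all: by end_near. Qed.

End Attained.

Theorem theorem3p1 (R : realType) (g : R[i] * R[i] -> R[i]) (hg : hardy2 g) :
  exists a b : R[i], [/\ disc a, disc b &
    forall a' b' : R[i], disc a' -> disc b' ->
      `|inner g (tensor (szego a') (szego b'))| <=
      `|inner g (tensor (szego a) (szego b))|].
Proof.
suff [a [b [a1 b1 H]]] : exists a b : R[i], [/\ disc a, disc b &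
    forall a' b' : R[i], disc a' -> disc b' ->
      szego_coef g a' b' <= szego_coef g a b].
  exists a, b; split; [exact: a1|exact: b1|move=> a' b' a'1 b'1].
  by have := H a' b' a'1 b'1; rewrite /szego_coef ler_normc.
have [[a0 [b0 [a01 b01 m0]]]|no] := pselect (exists a b : R[i],
    [/\ disc a, disc b & 0 < szego_coef g a b]); last first.
  have d0 : disc (0 : R[i]) by rewrite discE normc0.
  exists 0, 0; split; [exact: d0|exact: d0|move=> a b a1 b1].
  apply: (@le_trans _ _ 0).
    by rewrite leNgt; apply/negP => ab0; apply: no; exists a, b.
  exact: normc_ge0.
(* Outside the polydisc of radius [r0] the coefficient is at most its value
   at [(a0, b0)], so it is enough to maximize over a closed polydisc. *)
have [r0 r01 small] := szego_coef_small _ hg _ m0.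
pose r := Num.max r0 (Num.max (normc a0) (normc b0)).
have [na0 nb0] : normc a0 < 1 /\ normc b0 < 1 by rewrite -!discE.
have r1 : r < 1 by rewrite !gt_max r01 na0.
pose f (v : (R * R) * (R * R)) :=
  szego_coef g (complex_of v.1) (complex_of v.2).
have discr v : polydisc r v -> disc (complex_of v.1) /\ disc (complex_of v.2).
  by move=> [v1 v2]; rewrite !discE; split; exact: le_lt_trans r1.
have cf : {within polydisc r, continuous f}.
  apply: continuous_in_subspaceT => v /set_mem /discr[v1 v2].
  exact: continuous_szego_coef.
have attained a b : normc a <= r -> normc b <= r ->
    exists2 v, polydisc r v & f v = szego_coef g a b.
  move=> ar br; exists ((complex.Re a, complex.Im a),
    (complex.Re b, complex.Im b)).
    by case: a b ar br => [? ?] [? ?].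
  by case: a b ar br => [? ?] [? ?].
have [|| v0 Kv0 fv0] := attained a0 b0;
  [by rewrite !le_max lexx/= !orbT..|].
have [v /set_mem Kv vmax] :=
  compact_EVT_max (ex_intro _ v0 Kv0) (compact_polydisc r) cf.
have [v1 v2] := discr _ Kv.
exists (complex_of v.1), (complex_of v.2).
split; [exact: v1|exact: v2|move=> a b a1 b1].
have [/andP[ar br]|] := boolP ((normc a <= r) && (normc b <= r)).
  by have [w Kw <-] := attained a b ar br; exact: vmax (mem_set Kw).
rewrite negb_and -!ltNge !gt_max => outside.
have := vmax v0 (mem_set Kv0); rewrite fv0; apply: le_trans.
apply: (small a b a1 b1).
by case/orP: outside => /andP[? _]; [left|right].
Qed.
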